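(* Let $m_1\ge3$, $m_2\ge3$ and let $G$ be the group of type $\mathcal{D}_3$ $$G=\langle x,y,t_1,t_2\mid t_1^{2^{m_1}}=t_2^{2^{m_2}}=1,\ x^2=1,\ y^2=t_2,\ t_1,t_2\text{ central},\ (x,y)=t_1^{2^{m_1-1}}\rangle.$$ Set $$N=\begin{cases}2^{m_2}(5+4m_1-4m_2)-4 & \text{if } m_1-1\ge m_2+1,\\ 9(2^{m_2})-4 & \text{if } m_2=m_1-1,\\ 2^{m_1-1}(12+3m_2-3m_1)-4 & \text{if } m_1\le m_2,\end{cases}$$ $$N_0=\begin{cases}2^{m_2+2}(1+m_1-m_2)-4 & \text{if } m_1-1\ge m_2+1,\\ 8(2^{m_2})-4 & \text{if } m_2=m_1-1,\\ 2^{m_1}(5+m_2-m_1)-4 & \text{if } m_1\le m_2,\end{cases}$$ $M=2N-20$ and $M_0=2N_0-20$. Then $\mathbb{Q}G$ is the direct sum of $N_0$ fields and $N-N_0$ quaternion algebras. For any finite field $K$ of odd order $q$, $KG$ is the direct sum of at least $M_0$ fields and at least $M-M_0$ quaternion algebras, these numbers being achieved if $q\equiv3\pmod8$.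
   Context: $(x,y)$ denotes the group commutator. The centre of $G$ is $\langle t_1\rangle\times\langle t_2\rangle\cong C_{2^{m_1}}\times C_{2^{m_2}}$ and $|G|=4\cdot2^{m_1+m_2}$. A quaternion algebra means a $4$-dimensional central simple algebra over its centre (a field extension of the ground field); $2\times 2$ matrix rings over fields are included. ''Direct sum'' means direct sum of algebras (the Wedderburn decomposition). *)

(* Defs.v *)
From HB Require Import structures.
From mathcomp Require Import all_boot all_order all_algebra all_fingroup.
From mathcomp Require Import all_solvable all_field.

Set Implicit Arguments.
Unset Strict Implicit.
Unset Printing Implicit Defensive.

Import GRing.Theory.
Local Open Scope ring_scope.

(* Functions gT -> K with the convolution product; the element g of the group
   is identified with its indicator function. The target is K^o so that the
   library supplies the vector space structure. *)
Definition group_algebra (K : fieldType) (gT : finGroupType) : Type :=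
  {ffun gT -> K^o}.

HB.instance Definition _ (K : fieldType) (gT : finGroupType) :=
  Vector.copy (group_algebra K gT) {ffun gT -> K^o}.

Section GroupAlgebra.
Variables (K : fieldType) (gT : finGroupType).
Implicit Types a b c : group_algebra K gT.

Definition galg_one : group_algebra K gT := [ffun g : gT => (g == 1%g)%:R].

Definition galg_mul a b : group_algebra K gT :=
  [ffun g : gT => \sum_(h : gT) a h * b (h^-1 * g)%g].

Fact galg_mulA : associative galg_mul.
Proof.
move=> a b c; apply/ffunP=> g; rewrite !ffunE.
under eq_bigr => h _ do rewrite ffunE big_distrr /=.
under [RHS]eq_bigr => h _ do rewrite ffunE big_distrl /=.
rewrite [RHS]exchange_big /=; apply: eq_bigr => h _.
rewrite [RHS](reindex_inj (mulgI h)) /=; apply: eq_bigr => k _.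
by rewrite mulKg mulrA invMg mulgA.
Qed.

Fact galg_mul1 : left_id galg_one galg_mul.
Proof.
move=> a; apply/ffunP=> g; rewrite !ffunE (bigD1 1%g) //= ffunE eqxx mul1r.
rewrite invg1 mul1g big1 ?addr0 // => h /negPf h1.
by rewrite ffunE h1 mul0r.
Qed.

Fact galg_mulr1 : right_id galg_one galg_mul.
Proof.
move=> a; apply/ffunP=> g; rewrite !ffunE (bigD1 g) //= ffunE mulVg eqxx mulr1.
rewrite big1 ?addr0 // => h hg.
by rewrite ffunE -eq_mulVg1 (negPf hg) mulr0.
Qed.

Fact galg_mulDl : left_distributive galg_mul +%R.
Proof.
move=> a b c; apply/ffunP=> g; rewrite !ffunE -big_split /=.
by apply: eq_bigr => h _; rewrite ffunE mulrDl.
Qed.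

Fact galg_mulDr : right_distributive galg_mul +%R.
Proof.
move=> a b c; apply/ffunP=> g; rewrite !ffunE -big_split /=.
by apply: eq_bigr => h _; rewrite ffunE mulrDr.
Qed.

Fact galg_one_neq0 : galg_one != 0.
Proof.
apply/eqP => /ffunP/(_ 1%g); rewrite !ffunE eqxx.
by apply/eqP; rewrite oner_eq0.
Qed.

HB.instance Definition _ := GRing.Zmodule_isNzRing.Build (group_algebra K gT)
  galg_mulA galg_mul1 galg_mulr1 galg_mulDl galg_mulDr galg_one_neq0.

Fact galg_scaleAl (k : K) a b : k *: (a * b) = (k *: a) * b.
Proof.
apply/ffunP=> g; rewrite !ffunE scaler_sumr.
by apply: eq_bigr => h _; rewrite ffunE scalerAl.
Qed.

HB.instance Definition _ :=
  GRing.Lmodule_isLalgebra.Build K (group_algebra K gT) galg_scaleAl.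

Fact galg_scaleAr (k : K) a b : k *: (a * b) = a * (k *: b).
Proof.
apply/ffunP=> g; rewrite !ffunE scaler_sumr.
by apply: eq_bigr => h _; rewrite ffunE scalerAr.
Qed.

HB.instance Definition _ :=
  GRing.Lalgebra_isAlgebra.Build K (group_algebra K gT) galg_scaleAr.

HB.instance Definition _ := Algebra_isFalgebra.Build K (group_algebra K gT).

End GroupAlgebra.

Definition simple_algebra (L : fieldType) (A : falgType L) : Prop :=
  forall I : {vspace A}, ({:A} * I <= I)%VS -> (I * {:A} <= I)%VS ->
    I = 0%VS \/ I = {:A}%VS.

(* The centre is the scalar line 1%VS, so that L is the centre of A; matrix
   algebras 'M[L]_2 are not excluded. *)
Definition quaternion_algebra (L : fieldType) (A : falgType L) : Prop :=
  [/\ 'Z({:A})%VS = 1%VS, simple_algebra A & \dim {:A} = 4].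

(* B is isomorphic, as a K-algebra, to the product of f finite field extensions
   F i of K and of h quaternion algebras A j, each over its own centre L j, a
   finite field extension of K. The isomorphism is given by its components
   phi i and psi j, which are unital K-algebra morphisms; psi j satisfies
   psi j (k *: b) = k%:A *: psi j b, with k%:A the image of k in L j. The last
   condition says that b |-> (phi i b, psi j b) is bijective. *)
Definition sum_of_fields_and_quaternions
    (K : fieldType) (B : falgType K) (f h : nat) : Prop :=
  exists (F : 'I_f -> fieldExtType K) (L : 'I_h -> fieldExtType K)
         (A : forall j, falgType (L j))
         (phi : forall i, {lrmorphism B -> F i})
         (psi : forall j, {lrmorphism B -> A j | in_alg (L j) \; *:%R}),
    (forall j, quaternion_algebra (A j)) /\
    (forall (u : forall i, F i) (v : forall j, A j),
       exists! b : B, (forall i, phi i b = u i) /\ (forall j, psi j b = v j)).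

(* The library notion G \isog Grp (...) compares finite quotients only; this
   presentation defines a finite group (of order at most 4 * 2 ^ (m1 + m2)), so
   G is indeed the group presented. *)
Definition type_D3 (m1 m2 : nat) (gT : finGroupType) (G : {set gT}) : Prop :=
  (G \isog Grp (x : y : t1 : t2 :
     (t1 ^+ (2 ^ m1)%N = 1, t2 ^+ (2 ^ m2)%N = 1, x ^+ 2 = 1, y ^+ 2 = t2,
      [~ t1, x] = 1, [~ t1, y] = 1, [~ t1, t2] = 1,
      [~ t2, x] = 1, [~ t2, y] = 1,
      [~ x, y] = t1 ^+ (2 ^ (m1 - 1))%N)))%g.

Local Open Scope nat_scope.

(* The subtractions below are never truncated for m1, m2 >= 3. *)
Definition D3_N (m1 m2 : nat) : nat :=
  if m2 + 1 <= m1 - 1 then 2 ^ m2 * (5 + 4 * m1 - 4 * m2) - 4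
  else if m2 == m1 - 1 then 9 * 2 ^ m2 - 4
  else 2 ^ (m1 - 1) * (12 + 3 * m2 - 3 * m1) - 4.

Definition D3_N0 (m1 m2 : nat) : nat :=
  if m2 + 1 <= m1 - 1 then 2 ^ (m2 + 2) * (1 + m1 - m2) - 4
  else if m2 == m1 - 1 then 8 * 2 ^ m2 - 4
  else 2 ^ m1 * (5 + m2 - m1) - 4.

Definition D3_M (m1 m2 : nat) : nat := 2 * D3_N m1 m2 - 20.

Definition D3_M0 (m1 m2 : nat) : nat := 2 * D3_N0 m1 m2 - 20.

(* Main.v *)
(** G is modelled on triples (a, b, c), standing for x^a y^b t1^c. A linear
    character of G is given by the values (e, s, w) of x, y, t1, with w of order
    dividing 2^(m1-1); the other irreducible representations have dimension 2
    and send x to diag(1, -1), y to the matrix with rows (0, tau), (1, 0) and t1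
    to the scalar w, with w of order exactly 2^m1. Because x^2 = 1, all the
    quaternion algebras are split: they are matrix rings over the field
    generated by the values of the central character (tau, w).

    Let E be a Galois extension of K containing a primitive 2^n-th root of unity,
    n large. Choosing one character in each Galois orbit gives a map from K G to
    a product of fields and 2 x 2 matrix rings. It is injective, by Galois
    conjugation and Fourier inversion over E, and an orbit has as many elements
    as the degree over K of the corresponding field, so both sides have the same
    dimension and the map is bijective.

    The orbit of a character of order 2^k has size d_k = [K(zeta) : K], zeta a
    primitive 2^k-th root of unity. For K = Q, d_k = 2^(k-1). For K finite of
    odd order q, d_k is the order of q modulo 2^k, hence at most 1, 1, 2 for
    k = 0, 1, 2 and at most 2^(k-2) for k >= 3, with equality if q = 3 mod 8: at
    least as many orbits as over Q, and at least twice as many for k >= 3. *)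

From HB Require Import structures.
Require Import Defs.
From mathcomp Require Import all_boot all_order all_algebra all_fingroup.
From mathcomp Require Import all_solvable all_field integral_char.
From mathcomp Require Import zify ring ssrAC.

Set Implicit Arguments.
Unset Strict Implicit.
Unset Printing Implicit Defensive.

Import GRing.Theory.

Local Open Scope ring_scope.

(** * A model of the group *)

Lemma odd_modn_even (d i : nat) : ~~ odd d -> odd (i %% d) = odd i.
Proof. by move=> ed; rewrite {2}(divn_eq i d) oddD oddM (negPf ed) andbF. Qed.

Section Model.
Variables m1 m2 : nat.

(* The parameter m1 of the model is the m1 - 1 of the paper, so that t1 has order
   2 ^ m1.+1 and the commutator of x and y is t1 ^+ (2 ^ m1). *)
Definition D3_model : Type := 'Z_2 * 'Z_(2 ^ m2.+1) * 'Z_(2 ^ m1.+1).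
HB.instance Definition _ := Finite.on D3_model.

Definition D3_s : 'Z_(2 ^ m1.+1) := (2 ^ m1)%:R.

Lemma D3_sK : D3_s + D3_s = 0.
Proof.
rewrite /D3_s -natrD addnn -mul2n -expnS.
by apply: val_inj; rewrite Zp_nat /= !Zp_cast ?modnn // expnS leq_pmulr ?expn_gt0.
Qed.

Lemma odd_ZpD k (i j : 'Z_(2 ^ k.+1)) : odd (i + j)%R = odd i (+) odd j.
Proof.
rewrite /= odd_modn_even ?oddD // Zp_cast ?oddX //.
by rewrite expnS leq_pmulr ?expn_gt0.
Qed.

(** Moving y^b past x^a' costs the power b a' of the commutator. The latter has order 2, so only
    parities count, and they are additive because all moduli are even. *)
Definition D3_mul (g h : D3_model) : D3_model :=
  (g.1.1 + h.1.1, g.1.2 + h.1.2,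
   g.2 + h.2 + D3_s *+ (odd g.1.2 && odd h.1.1)).

Definition D3_inv (g : D3_model) : D3_model :=
  (- g.1.1, - g.1.2, - g.2 + D3_s *+ (odd g.1.2 && odd g.1.1)).

Lemma D3_sb (x y : bool) : D3_s *+ (x (+) y) = D3_s *+ x + D3_s *+ y.
Proof. by case: x; case: y; rewrite ?mulr0n ?addr0 ?add0r //= D3_sK. Qed.

Lemma odd_ZpN k (i : 'Z_(2 ^ k.+1)) : odd (- i)%R = odd i.
Proof.
have := odd_ZpD (- i) i; rewrite addNr.
by case: (odd (- i)%R); case: (odd i).
Qed.

Fact D3_mulA : associative D3_mul.
Proof.
move=> [[a b] c] [[a' b'] c'] [[a'' b''] c'']; rewrite /D3_mul /=.
congr (_, _, _); rewrite ?addrA //.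
rewrite (odd_ZpD (k := 0)) odd_ZpD andb_addl andb_addr !D3_sb.
by rewrite !addrA [RHS](ACl (1 * 2 * 4 * 6 * 3 * 5)).
Qed.

Fact D3_mul1 : left_id ((0, 0, 0) : D3_model) D3_mul.
Proof. by move=> [[a b] c]; rewrite /D3_mul /= !add0r addr0. Qed.

Fact D3_mulV : left_inverse ((0, 0, 0) : D3_model) D3_inv D3_mul.
Proof.
move=> [[a b] c]; rewrite /D3_mul /D3_inv /= !addNr odd_ZpN.
by rewrite [- c + _ + c]addrAC addNr add0r -mulrnDl D3_sK mul0rn.
Qed.

HB.instance Definition _ :=
  Finite_isGroup.Build D3_model D3_mulA D3_mul1 D3_mulV.

Lemma card_D3_model : #|{: D3_model}| = (2 ^ (m1 + m2 + 3))%N.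
Proof.
rewrite !card_prod !card_ord !Zp_cast ?(expnS, leq_pmulr) ?expn_gt0 //.
by rewrite !expnD; lia.
Qed.

End Model.

Lemma Zp_trunc_exp2 k : (Zp_trunc (2 ^ k.+1)).+2 = (2 ^ k.+1)%N.
Proof. by rewrite Zp_cast // expnS leq_pmulr ?expn_gt0. Qed.

Lemma val_ZpD k (i j : 'Z_(2 ^ k.+1)) : (i + j)%R = ((i + j) %% 2 ^ k.+1)%N :> nat.
Proof. by congr (_ %% _)%N; exact: Zp_trunc_exp2. Qed.

Lemma val_Zp_sb k (b : bool) : D3_s k *+ b = (2 ^ k * b)%N :> nat.
Proof.
case: b; rewrite ?mulr0n ?muln0 // mulr1n muln1 /D3_s Zp_nat /=.
by rewrite Zp_trunc_exp2 modn_small // ltn_exp2l.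
Qed.

Section GroupWords.
Variables (m1 m2 : nat) (gT : finGroupType) (x y t : gT).
Local Open Scope group_scope.
Hypotheses (x2 : x ^+ 2 = 1) (yn : y ^+ (2 ^ m2.+1)%N = 1).
Hypotheses (tn : t ^+ (2 ^ m1.+1)%N = 1).
Hypotheses (tx : commute t x) (ty : commute t y).
Hypothesis yx : y * x = x * y * t ^+ (2 ^ m1)%N.

Definition D3_word (g : D3_model m1 m2) : gT := x ^+ g.1.1 * y ^+ g.1.2 * t ^+ g.2.

Lemma expg_ZpD k (u : gT) (i j : 'Z_(2 ^ k.+1)) :
  u ^+ (2 ^ k.+1)%N = 1 -> u ^+ (i + j)%R = u ^+ i * u ^+ j.
Proof. by move=> u1; rewrite val_ZpD expg_mod ?expgD. Qed.

Lemma expg_yx a b :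
  y ^+ b * x ^+ a = x ^+ a * y ^+ b * (t ^+ (2 ^ m1)%N) ^+ (b * a)%N.
Proof.
set s := t ^+ (2 ^ m1)%N.
have sx : commute s x by exact/commute_sym/commuteX/commute_sym.
have sy : commute s y by exact/commute_sym/commuteX/commute_sym.
have yxa : y * x ^+ a = x ^+ a * y * s ^+ a.
  elim: a => [|a IH]; first by rewrite !expg0 mul1g !mulg1.
  rewrite expgSr mulgA IH -!mulgA -[s ^+ a * x](commuteX a (commute_sym sx)).
  by rewrite (mulgA y) yx -!mulgA expgS.
elim: b => [|b IH]; first by rewrite mul0n !expg0 mul1g !mulg1.
rewrite expgS -mulgA IH !mulgA yxa -!mulgA; congr (_ * (_ * _)).
rewrite mulSn expgD !mulgA; congr (_ * _).
exact: commuteX2 sy.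
Qed.

(** Only the defining relations are used, so the model maps to every group in which they hold. *)
Lemma D3_wordM g h : D3_word (g * h) = D3_word g * D3_word h.
Proof.
case: g h => [[a b] c] [[a' b'] c'].
transitivity (x ^+ (a + a')%R * y ^+ (b + b')%R *
  t ^+ (c + c' + D3_s m1 *+ (odd b && odd a'))%R) => //.
transitivity (x ^+ a * y ^+ b * t ^+ c * (x ^+ a' * y ^+ b' * t ^+ c')) => //.
have s2 : (t ^+ (2 ^ m1)) ^+ 2 = 1 by rewrite -expgM -expnSr.
rewrite (expg_ZpD (k := 0)) // !expg_ZpD // val_Zp_sb.
rewrite expgM -oddM -modn2 (expg_mod _ s2).
have tX i j : commute (t ^+ i) (x ^+ j) by exact: commuteX2.
have tY i j : commute (t ^+ i) (y ^+ j) by exact: commuteX2.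
rewrite -!mulgA; congr (_ * _).
rewrite [t ^+ c * (x ^+ a' * _)]mulgA tX -!mulgA [y ^+ b * (x ^+ a' * _)]mulgA.
rewrite expg_yx -!mulgA -expgM; congr (_ * (_ * _)).
rewrite [t ^+ c * (y ^+ _ * _)]mulgA tY -mulgA [RHS]mulgA tY -mulgA; congr (_ * _).
by rewrite -!expgD; congr (_ ^+ _); lia.
Qed.

End GroupWords.

Section ModelGenerators.
Variables m1 m2 : nat.
Local Notation H := (D3_model m1 m2).
Local Notation X := ((1, 0, 0) : H).
Local Notation Y := ((0, 1, 0) : H).
Local Notation T := ((0, 0, 1) : H).

Lemma D3_expX n : (X ^+ n)%g = (n%:R, 0, 0) :> H.
Proof.
elim: n => // n IH; rewrite expgS IH [(_ * _)%g]/(D3_mul _ _) /D3_mul.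
by rewrite -natr1 [n%:R + 1]addrC !addr0.
Qed.

Lemma D3_expY n : (Y ^+ n)%g = (0, n%:R, 0) :> H.
Proof.
elim: n => // n IH; rewrite expgS IH [(_ * _)%g]/(D3_mul _ _) /D3_mul.
by rewrite -natr1 [n%:R + 1]addrC andbF !addr0.
Qed.

Lemma D3_expT n : (T ^+ n)%g = (0, 0, n%:R) :> H.
Proof.
elim: n => // n IH; rewrite expgS IH [(_ * _)%g]/(D3_mul _ _) /D3_mul.
by rewrite -natr1 [n%:R + 1]addrC !addr0.
Qed.

Lemma D3_genE (g : H) : g = (X ^+ g.1.1 * Y ^+ g.1.2 * T ^+ g.2)%g.
Proof.
case: g => [[a b] c]; rewrite D3_expX D3_expY D3_expT /=.
have -> : (((a%:R, 0, 0) : H) * ((0, b%:R, 0) : H))%g = (a, b, 0) :> H.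
  by rewrite [(_ * _)%g]/(D3_mul _ _) /D3_mul !natr_Zp !add0r !addr0.
rewrite [(_ * _)%g]/(D3_mul _ _) /D3_mul natr_Zp.
have -> : D3_s m1 *+ (odd b && odd (0%R : 'Z_2)) = 0 by rewrite andbF.
by rewrite [_.1.1]/= [_.1.2]/= [_.2]/= add0r !addr0.
Qed.

Lemma Zp_exp2_nat k : (2 ^ k.+1)%:R = 0 :> 'Z_(2 ^ k.+1).
Proof. by apply: val_inj; rewrite Zp_nat /= Zp_trunc_exp2 modnn. Qed.

(** The generators of the model satisfy the relations, with y^2 in the role of t2, so the universal
    property of the presentation applies. *)
Lemma D3_model_homg (gT : finGroupType) :
  type_D3 m1.+1 m2 [set: gT] -> ([set: H] \homg [set: gT])%g.
Proof.
rewrite /type_D3 subn1 /= => ->; apply/existsP.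
have Tn : (T ^+ (2 ^ m1.+1) = 1 :> H)%g by rewrite D3_expT Zp_exp2_nat.
have TC g : commute T g.
  case: g => [[a b] c]; rewrite /commute ![(_ * _)%g]/(D3_mul _ _) /D3_mul.
  have -> : D3_s m1 *+ (odd b && odd (0%R : 'Z_2)) = 0 by rewrite andbF.
  by rewrite [_.1.1]/= [_.1.2]/= [_.2]/= !add0r !addr0 addrC.
have YX : (Y * X = X * Y * T ^+ (2 ^ m1) :> H)%g.
  have -> : (Y * X)%g = (1, 1, D3_s m1) :> H.
    rewrite [(_ * _)%g]/(D3_mul _ _) /D3_mul.
    have -> : odd (1%R : 'Z_(2 ^ m2.+1)) by [].
    by rewrite [_.1.1]/= [_.1.2]/= [_.2]/= !add0r !addr0.
  have -> : (X * Y)%g = (1, 1, 0) :> H.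
    by rewrite [(_ * _)%g]/(D3_mul _ _) /D3_mul !add0r !addr0.
  rewrite D3_expT [(_ * _)%g]/(D3_mul _ _) /D3_mul.
  have -> : D3_s m1 *+ (odd (1%R : 'Z_(2 ^ m2.+1)) && odd (0%R : 'Z_2)) = 0.
    by rewrite andbF.
  by rewrite [_.1.1]/= [_.1.2]/= [_.2]/= add0r !addr0.
have S2 : ((T ^+ (2 ^ m1)) ^+ 2 = 1 :> H)%g by rewrite -expgM -expnSr.
exists (X, Y, T, Y ^+ 2)%g; apply/eqP => /=.
have -> : (<[X]> <*> <[Y]> <*> <[T]> <*> <[Y ^+ 2]> = [set: H])%g.
  apply/eqP; rewrite eqEsubset subsetT; apply/subsetP=> g _.
  rewrite (D3_genE g) !groupM ?groupX //.
  - by do 3!apply: (subsetP (joing_subl _ _)); rewrite cycle_id.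
  - do 2!apply: (subsetP (joing_subl _ _)).
    by apply: (subsetP (joing_subr _ _)); rewrite cycle_id.
  - apply: (subsetP (joing_subl _ _)).
    by apply: (subsetP (joing_subr _ _)); rewrite cycle_id.
have Y2n : (Y ^+ 2 ^+ (2 ^ m2) = 1 :> H)%g.
  by rewrite -expgM -expnS D3_expY Zp_exp2_nat.
have X2 : (X ^+ 2 = 1 :> H)%g.
  by rewrite D3_expX; congr (_, _, _); apply: val_inj.
have Y2X : ([~ Y ^+ 2, X] = 1 :> H)%g.
  by apply/eqP/commgP; have := expg_yx (TC _) (TC _) YX 1 2; rewrite S2 mulg1.
have Y2Y : ([~ Y ^+ 2, Y] = 1 :> H)%g by exact/eqP/commgP/commute_sym/commuteX.
have XY : ([~ X, Y] = T ^+ (2 ^ m1) :> H)%g.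
  apply: (mulgI (Y * X)%g); rewrite -commgC YX -mulgA -expgD addnn -mul2n.
  by rewrite -expnS Tn mulg1.
have TR g : ([~ T, g] = 1 :> H)%g by exact/eqP/commgP.
by rewrite Tn Y2n X2 Y2X Y2Y XY !TR.
Qed.

End ModelGenerators.

(** Words in the generators map the model onto the group; as the model is also an image of the
    group, the cardinals agree and the word map is bijective. *)
Lemma D3_model_iso m1 m2 (gT : finGroupType) :
  type_D3 m1.+1 m2 [set: gT] ->
  exists f : gT -> D3_model m1 m2,
    bijective f /\ {morph f : g h / (g * h)%g}.
Proof.
move=> D3G; have homG := D3_model_homg D3G; move: D3G.
rewrite /type_D3 subn1 /= => isoG.
have [x [y [t [defG tn yn x2 [tx ty yx]]]]] : exists x y t : gT,
    [/\ (<[x]> <*> <[y]> <*> <[t]>)%g = [set: gT], (t ^+ (2 ^ m1.+1) = 1)%g,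
     (y ^+ (2 ^ m2.+1) = 1)%g, (x ^+ 2 = 1)%g & [/\ commute t x, commute t y &
     (y * x = x * y * t ^+ (2 ^ m1))%g]].
  have /existsP[[[[x y] t1] t2]] /= := isoGrp_hom isoG.
  case/eqP=> defG t1n t2n x2 y2 /eqP/commgP t1x /eqP/commgP t1y _ _ _ xy.
  exists x, y, t1.
  have yn : (y ^+ (2 ^ m2.+1) = 1)%g by rewrite expnS expgM y2.
  (* The factor generated by t2 is absorbed by the one of y, because y^2 = t2. *)
  split=> //; first rewrite -defG -y2.
    apply/esym/joing_idPl; rewrite cycle_subG groupX // mem_gen // !inE.
    by rewrite mem_gen ?orbT // !inE cycle_id orbT.
  split=> //.
  by rewrite (commgC x) xy -mulgA -expgD addnn -mul2n -expnS t1n mulg1.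
pose W := D3_word (m1 := m1) (m2 := m2) x y t.
have WM : {morph W : g h / (g * h)%g} by exact: D3_wordM.
pose fW : {morphism [set: D3_model m1 m2] >-> gT} := Morphism (in2W WM).
have img1 i : W i \in (fW @* setT)%g by rewrite (mem_morphim fW) ?inE.
have Wx : W (1, 0, 0) = x by rewrite /W /D3_word /= !expg0 !mulg1.
have Wy : W (0, 1, 0) = y by rewrite /W /D3_word /= !expg0 mul1g mulg1.
have Wt : W (0, 0, 1) = t by rewrite /W /D3_word /= !expg0 !mul1g.
have surj : (fW @* setT = [set: gT])%g.
  apply/eqP; rewrite eqEsubset subsetT -defG !join_subG !cycle_subG.
  by rewrite -{1}Wx -{1}Wy -Wt !img1.
have le_card : (#|{: D3_model m1 m2}| <= #|gT|)%N by rewrite -!cardsT leq_homg.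
have injW : injective W.
  have /imset_injP injW : #|W @: setT| == #|[set: D3_model m1 m2]|.
    rewrite eqn_leq leq_imset_card /= cardsT (leq_trans le_card) //.
    by rewrite -cardsT -surj morphimEdom.
  by move=> g h; apply: injW.
have [|f fK Kf] := inj_card_bij injW.
  by rewrite -[#|gT|]cardsT -surj morphimEdom -[leqRHS]cardsT leq_imset_card.
exists f; split=> [|g h]; first by exists W.
by apply: injW; rewrite WM !Kf.
Qed.

(** * Morphisms from the group algebra *)

Section Lift.
Variables (K : fieldType) (gT : finGroupType) (A : nzRingType).
Variables (s : GRing.Scale.law K A) (c : {rmorphism K -> A}) (rho : gT -> A).
Hypothesis sE : forall k a, s k a = c k * a.
Hypothesis cC : forall k a, c k * a = a * c k.
Hypothesis rho1 : rho 1%g = 1.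
Hypothesis rhoM : {morph rho : g h / (g * h)%g >-> g * h}.

(** The scaling law [s] is abstract, given by the central elements [c k], so that one construction
    serves both the fields and the matrix rings, whose law goes through their centre. *)
Definition galg_lift (b : group_algebra K gT) : A := \sum_g s (b g) (rho g).

Fact galg_lift_linear : linear_for s galg_lift.
Proof.
move=> k a b; rewrite /galg_lift sE mulr_sumr -big_split /=; apply: eq_bigr => g _.
by rewrite !sE !ffunE rmorphD mulrDl rmorphM mulrA.
Qed.

Fact galg_lift_monoid : monoid_morphism galg_lift.
Proof.
split=> [|a b]; rewrite /galg_lift.
  rewrite (bigD1 1%g) //= big1 ?addr0 => [|g /negPf g1].
    by rewrite sE ffunE eqxx rho1 rmorph1 mulr1.
  by rewrite sE ffunE g1 rmorph0 mul0r.
rewrite mulr_suml; under eq_bigr => g _.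
  rewrite sE ffunE rmorph_sum mulr_suml; over.
rewrite exchange_big; apply: eq_bigr => h _ /=.
rewrite (reindex_inj (mulgI h)) mulr_sumr; apply: eq_bigr => g _ /=.
by rewrite mulKg !sE rhoM rmorphM -!mulrA; congr (_ * _); rewrite !mulrA cC.
Qed.

Lemma galg_lift_lrmorphism :
  {f : {lrmorphism group_algebra K gT -> A | s} | f =1 galg_lift}.
Proof.
pose f0 := GRing.isLinear.Build K (group_algebra K gT) A s
  galg_lift galg_lift_linear.
pose f1 := GRing.isMonoidMorphism.Build (group_algebra K gT) A
  galg_lift galg_lift_monoid.
pose f : {lrmorphism group_algebra K gT -> A | s} := HB.pack galg_lift f0 f1.
by exists f.
Qed.

End Lift.

Section CoordinateSystem.
Variables (K : fieldType) (E : vectType K) (G I : finType).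
Variables (V : I -> {vspace E}) (e : I -> G -> E).

Definition coord_map (b : {ffun G -> K^o}) : {ffun I -> E} :=
  [ffun i => \sum_g b g *: e i g].
Fact coord_map_linear : linear coord_map.
Proof.
move=> k b c; apply/ffunP=> i; rewrite !ffunE scaler_sumr -big_split /=.
by apply: eq_bigr => g _; rewrite !ffunE scalerDl scalerA.
Qed.
HB.instance Definition _ := GRing.isLinear.Build K {ffun G -> K^o} {ffun I -> E}
  _ coord_map coord_map_linear.

Definition ffun_inj (i : I) (u : E) : {ffun I -> E} :=
  [ffun j => if j == i then u else 0].
Fact ffun_inj_linear i : linear (ffun_inj i).
Proof.
move=> k u v; apply/ffunP=> j; rewrite !ffunE.
by case: (j == i); rewrite // scaler0 addr0.
Qed.
HB.instance Definition _ i := GRing.isLinear.Build K E {ffun I -> E}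
  _ (ffun_inj i) (ffun_inj_linear i).

Lemma ffun_injE (w : {ffun I -> E}) : w = \sum_i ffun_inj i (w i).
Proof.
apply/ffunP=> i; rewrite sum_ffunE (bigD1 i) //= big1 => [|j ji].
  by rewrite ffunE eqxx addr0.
by rewrite ffunE eq_sym (negPf ji).
Qed.

(** An injective linear map into a space of dimension at most that of its source is onto. All
    components are read inside the same [E], the i-th one in the subspace [V i]. *)
Lemma coord_map_surj :
    (forall i g, e i g \in V i) -> (\sum_i \dim (V i) <= #|G|)%N ->
    (forall b : {ffun G -> K^o}, coord_map b = 0 -> b = 0) ->
  forall w : {ffun I -> E}, (forall i, w i \in V i) ->
  exists b, coord_map b = w.
Proof.
move=> eV leV inj w wV; pose f := linfun coord_map.
pose W := (\sum_i linfun (ffun_inj i) @: V i)%VS.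
have inW (u : {ffun I -> E}) : (forall i, u i \in V i) -> u \in W.
  move=> uV; rewrite [u]ffun_injE; apply: memv_sumr => i _.
  by apply/memv_imgP; exists (u i); rewrite ?lfunE.
have fW : (limg f <= W)%VS.
  apply/subvP=> _ /memv_imgP[b _ ->]; apply: inW => i.
  by rewrite lfunE ffunE memv_suml // => g _; rewrite memvZ.
have kf : lker f == 0%VS.
  apply/eqP/vspaceP=> b; rewrite memv_ker memv0 lfunE /=.
  by apply/eqP/eqP => [/inj //|->]; rewrite linear0.
have dimf : \dim (limg f) = #|G|.
  rewrite limg_dim_eq; last by rewrite (eqP kf) capv0.
  by rewrite dimvf [dim _]muln1.
have dimW : (\dim W <= \dim (limg f))%N.
  rewrite dimf (leq_trans _ leV) // (leq_trans (dimv_leq_sum _ _ _)) //.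
  apply: leq_sum => i _.
  by rewrite -[leqRHS](limg_ker_dim (linfun (ffun_inj i))) leq_addl.
have eqW : limg f = W by apply/eqP; rewrite eqEdim fW dimW.
have /memv_imgP[b _ ->] : w \in limg f by rewrite eqW inW.
by exists b; rewrite lfunE.
Qed.

End CoordinateSystem.

(** * Representations of the group *)

Section RingWords.
Variables (m1 m2 : nat) (A : nzRingType) (x y t : A).

(** The analogue of [D3_word] for plain ring elements, so that matrices can be used without passing
    to a unit group. *)
Definition D3_rword (g : D3_model m1 m2) : A := x ^+ g.1.1 * y ^+ g.1.2 * t ^+ g.2.

Lemma D3_rword1 : D3_rword 1%g = 1.
Proof. by rewrite /D3_rword /= !expr0 !mulr1. Qed.

Hypotheses (x2 : x ^+ 2 = 1) (yn : y ^+ (2 ^ m2.+1)%N = 1).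
Hypotheses (tn : t ^+ (2 ^ m1.+1)%N = 1).
Hypotheses (tx : GRing.comm t x) (ty : GRing.comm t y).
Hypothesis yx : y * x = x * y * t ^+ (2 ^ m1)%N.

Lemma expr_ZpD k (u : A) (i j : 'Z_(2 ^ k.+1)) :
  u ^+ (2 ^ k.+1)%N = 1 -> u ^+ (i + j)%R = u ^+ i * u ^+ j.
Proof. by move=> u1; rewrite val_ZpD expr_mod ?exprD. Qed.

Lemma expr_yx a b :
  y ^+ b * x ^+ a = x ^+ a * y ^+ b * (t ^+ (2 ^ m1)%N) ^+ (b * a)%N.
Proof.
set s := t ^+ (2 ^ m1)%N.
have sx : GRing.comm s x by exact/commr_sym/commrX/commr_sym.
have sy : GRing.comm s y by exact/commr_sym/commrX/commr_sym.
have yxa : y * x ^+ a = x ^+ a * y * s ^+ a.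
  elim: a => [|a IH]; first by rewrite !expr0 mul1r !mulr1.
  rewrite exprSr mulrA IH -!mulrA -[s ^+ a * x](commrX a (commr_sym sx)).
  by rewrite (mulrA y) yx -!mulrA exprS.
elim: b => [|b IH]; first by rewrite mul0n !expr0 mul1r !mulr1.
rewrite exprS -mulrA IH !mulrA yxa -!mulrA; congr (_ * (_ * _)).
rewrite mulSn exprD !mulrA; congr (_ * _).
exact/commrX/commr_sym/commrX/commr_sym.
Qed.

Lemma D3_rwordM : {morph D3_rword : g h / (g * h)%g >-> g * h}.
Proof.
move=> [[a b] c] [[a' b'] c'].
transitivity (x ^+ (a + a')%R * y ^+ (b + b')%R *
  t ^+ (c + c' + D3_s m1 *+ (odd b && odd a'))%R) => //.
transitivity (x ^+ a * y ^+ b * t ^+ c * (x ^+ a' * y ^+ b' * t ^+ c')) => //.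
have s2 : (t ^+ (2 ^ m1)) ^+ 2 = 1 by rewrite -exprM -expnSr.
rewrite (expr_ZpD (k := 0)) // !expr_ZpD // val_Zp_sb.
rewrite exprM -oddM -modn2 (expr_mod _ s2).
have tX i j : t ^+ i * x ^+ j = x ^+ j * t ^+ i.
  exact/commrX/commr_sym/commrX/commr_sym.
have tY i j : t ^+ i * y ^+ j = y ^+ j * t ^+ i.
  exact/commrX/commr_sym/commrX/commr_sym.
rewrite -!mulrA; congr (_ * _).
rewrite [t ^+ c * (x ^+ a' * _)]mulrA tX -!mulrA [y ^+ b * (x ^+ a' * _)]mulrA.
rewrite expr_yx -!mulrA -exprM; congr (_ * (_ * _)).
rewrite [t ^+ c * (y ^+ _ * _)]mulrA tY -mulrA [RHS]mulrA tY -mulrA; congr (_ * _).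
by rewrite -!exprD; congr (_ ^+ _); lia.
Qed.

End RingWords.

(** A matrix commuting with the elementary matrices is scalar; multiplying a matrix with a nonzero
    entry on both sides by elementary ones produces every elementary matrix. *)
Lemma mx2_quaternion (L : fieldType) : @quaternion_algebra L 'M[L]_2.
Proof.
have delta_mulE (M : 'M[L]_2) i j k l : (M * delta_mx i j) k l = M k i *+ (l == j).
  rewrite mxE (bigD1 i) //= big1 => [|h hi]; last first.
    by rewrite mxE (negPf hi) mulr0.
  by rewrite mxE eqxx addr0 mulr_natr.
have mul_deltaE (M : 'M[L]_2) i j k l : (delta_mx i j * M) k l = M j l *+ (k == i).
  rewrite mxE (bigD1 j) //= big1 => [|h hj]; last first.
    by rewrite mxE (negPf hj) andbF mul0r.
  by rewrite mxE eqxx andbT addr0 mulr_natl.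
split=> [|I lI rI|]; last by rewrite dimvf.
  apply/eqP; rewrite eqEsubv; apply/andP; split; last first.
    apply/subvP=> _ /vlineP[k ->]; rewrite memv_cap memvf; apply/centvP=> M _.
    by rewrite -scalerAl -scalerAr mul1r mulr1.
  apply/subvP=> M; rewrite memv_cap memvf => /centvP MC.
  apply/vlineP; exists (M 0 0); apply/matrixP=> k j.
  have /matrixP/(_ k 0) := MC (delta_mx j 0) (memvf _).
  by rewrite delta_mulE mul_deltaE eqxx mulr1n !mxE mulr_natr => ->.
have [->|I0] := eqVneq I 0%VS; [by left | right].
have MI : vpick I \in I by exact: memv_pick.
have /matrix0Pn[p [q Mpq]] : vpick I != 0 by rewrite vpick0.
apply/eqP; rewrite eqEsubv subvf; apply/subvP=> N _.
rewrite [N]matrix_sum_delta; apply: memv_suml => i _; apply: memv_suml => j _.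
apply: memvZ.
have -> : delta_mx i j = (vpick I p q)^-1 *: (delta_mx i p * vpick I * delta_mx q j).
  apply/matrixP=> k l; rewrite [RHS]mxE delta_mulE mul_deltaE !mxE.
  by case: eqP; case: eqP; rewrite ?mulr0n ?mulr0 //= mulVf.
apply/memvZ/(subvP rI)/memv_mul/memvf/(subvP lI)/memv_mul/MI/memvf.
Qed.

Section Representations.
Variables (m1 m2 : nat) (L : fieldType).
Local Notation H := (D3_model m1 m2).

Definition D3_lin (e s w : L) : H -> L := D3_rword e s w.

Definition mxX : 'M[L]_2 := \matrix_(i, j) ((-1) ^+ i *+ (i == j)).
Definition mxY (tau : L) : 'M[L]_2 :=
  \matrix_(i, j) (if i == 0 then tau *+ (j == 1) else (j == 0)%:R).
Definition D3_quat (tau w : L) : H -> 'M[L]_2 := D3_rword mxX (mxY tau) w%:M.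

(** The commutator t1^(2^m1) must go to 1 in a field, which is why the order of [w] divides 2^m1
    although t1 has order 2^(m1+1). *)
Lemma D3_linM (e s w : L) : e ^+ 2 = 1 -> s ^+ (2 ^ m2.+1) = 1 ->
  w ^+ (2 ^ m1) = 1 -> {morph D3_lin e s w : g h / (g * h)%g >-> g * h}.
Proof.
move=> e2 sn wn; apply: D3_rwordM => //; rewrite /GRing.comm.
- by rewrite expnSr exprM wn expr1n.
- by rewrite mulrC.
- by rewrite mulrC.
by rewrite wn mulr1 mulrC.
Qed.

Lemma D3_quatM (tau w : L) : tau ^+ (2 ^ m2) = 1 -> w ^+ (2 ^ m1) = -1 ->
  {morph D3_quat tau w : g h / (g * h)%g >-> g * h}.
Proof.
move=> tn wn.
have Y2 : mxY tau ^+ 2 = tau%:M.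
  by apply/matrixP=> i j; rewrite expr2 mxE 2!big_ord_recl big_ord0 !mxE;
    case: i j => [[|[|]] // ?] [[|[|]] // ?];
    rewrite /= ?(mulr0n, mulr1n, mul0r, mulr0, addr0, add0r, mul1r, mulr1).
have wX k : w%:M ^+ k = (w ^+ k)%:M :> 'M[L]_2 by rewrite rmorphXn.
apply: D3_rwordM; rewrite /GRing.comm.
- by apply/matrixP=> i j; rewrite expr2 mxE 2!big_ord_recl big_ord0 !mxE;
    case: i j => [[|[|]] // ?] [[|[|]] // ?]; rewrite /=
      ?(mulr0n, mulr1n, mul0r, mulr0, addr0, add0r, mul1r, mulr1, mulrNN).
- by rewrite expnS exprM Y2 -rmorphXn tn rmorph1.
- by rewrite wX expnSr exprM wn sqrrN expr1n.
- exact: esym (scalar_mxC _ _).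
- exact: esym (scalar_mxC _ _).
rewrite wX wn; apply/matrixP=> i j.
rewrite !mxE !big_ord_recl !big_ord0 !mxE !big_ord_recl !big_ord0 !mxE.
by case: i j => [[|[|]] // ?] [[|[|]] // ?]; rewrite /=
  ?(mulr0n, mulr1n, mul0r, mulr0, addr0, add0r, mul1r, mulr1, mulrNN).
Qed.

End Representations.

Lemma D3_lin_map m1 m2 (L L' : fieldType) (f : {rmorphism L -> L'}) (e s w : L)
    (g : D3_model m1 m2) : f (D3_lin e s w g) = D3_lin (f e) (f s) (f w) g.
Proof. by rewrite /D3_lin /D3_rword !rmorphM !rmorphXn. Qed.

Lemma D3_quat_map m1 m2 (L L' : fieldType) (f : {rmorphism L -> L'}) (tau w : L)
    (g : D3_model m1 m2) : map_mx f (D3_quat tau w g) = D3_quat (f tau) (f w) g.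
Proof.
rewrite /D3_quat /D3_rword !rmorphM !rmorphXn /= map_scalar_mx.
congr (_ ^+ _ * _ ^+ _ * _); apply/matrixP=> i j; rewrite !mxE.
  by rewrite rmorphMn rmorphXn rmorphN1.
by case: ifP => _; rewrite rmorphMn ?rmorph1.
Qed.

(* The row p is an eigenvector of X on the left and the column (s, 1) is an
   eigenvector of Y on the right, so a combination of the entries of the matrix
   of g is, up to a constant, the product of the eigenvalues; this makes the
   two-dimensional representations accessible to Fourier inversion. *)
Lemma D3_quat_eigen m1 m2 (L : fieldType) (p : 'I_2) (s w : L) (g : D3_model m1 m2) :
  D3_quat (s ^+ 2) w g p 0 * s + D3_quat (s ^+ 2) w g p 1 =
  D3_lin ((-1) ^+ p) s w g * (if p == 0 then s else 1).
Proof.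
pose r : 'cV[L]_2 := \col_i (if i == 0 then s else 1).
have Yr : mxY (s ^+ 2) *m r = s *: r.
  apply/matrixP=> i j; rewrite !mxE !big_ord_recl big_ord0 !mxE.
  by case: i => [[|[|]] // ?]; rewrite /=
    ?(mulr0n, mulr1n, mul0r, mulr0, addr0, add0r, mul1r, mulr1).
have Ynr k : mxY (s ^+ 2) ^+ k *m r = s ^+ k *: r.
  elim: k => [|k IH]; first by rewrite !expr0 mul1mx scale1r.
  by rewrite exprSr -mulmxE -mulmxA Yr -scalemxAr IH scalerA -exprS.
have Xp k (v : 'cV[L]_2) : (mxX L ^+ k *m v) p 0 = ((-1) ^+ p) ^+ k * v p 0.
  elim: k => [|k IH]; first by rewrite !expr0 mul1mx mul1r.
  rewrite exprS -mulmxE -mulmxA mxE (bigD1 p) //= big1 => [|j jp].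
    by rewrite IH mxE eqxx mulr1n addr0 exprS mulrA.
  by rewrite mxE eq_sym (negPf jp) mul0r.
transitivity ((D3_quat (s ^+ 2) w g *m r) p 0).
  move: (D3_quat _ _ _) => Q; rewrite mxE !big_ord_recl big_ord0 !mxE addr0 /= mulr1.
  by congr (_ + Q _ _); apply: val_inj.
rewrite /D3_quat /D3_lin /D3_rword -!mulmxE -!mulmxA.
have -> k : (w%:M : 'M[L]_2) ^+ k = (w ^+ k)%:M by rewrite rmorphXn.
by rewrite mul_scalar_mx -scalemxAr Ynr Xp !mxE !mulrA; ring.
Qed.

(** The [f i] are the coefficients of a polynomial of degree less than n that vanishes at the n
    distinct powers of [z]. *)
Lemma fourier_inj (E : fieldType) n (z : E) (f : 'I_n -> E) :
    n.-primitive_root z ->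
    (forall u, u ^+ n = 1 -> \sum_i f i * u ^+ i = 0) ->
  forall i, f i = 0.
Proof.
move=> zn fn i.
pose p := \poly_(j < n) oapp f 0 (insub j).
have p0 : p = 0.
  apply/eqP; apply: contraT => p0.
  have := max_poly_roots (rs := [seq z ^+ (j : 'I_n) | j <- enum 'I_n]) p0.
  rewrite size_map size_enum_ord ltnNge size_poly; apply; last first.
    rewrite map_inj_in_uniq ?enum_uniq // => j k _ _ /eqP.
    by rewrite (eq_prim_root_expr zn) !modn_small // => /eqP/val_inj.
  apply/allP=> _ /mapP[j _ ->]; rewrite /root horner_poly.
  have zj : (z ^+ j) ^+ n = 1 by rewrite exprAC (prim_expr_order zn) expr1n.
  by rewrite -[X in _ == X](fn _ zj); apply/eqP/eq_bigr => k _; rewrite valK.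
have := coef_poly n (fun j => oapp f 0 (insub j)) i.
by rewrite -/p p0 coef0 ltn_ord valK.
Qed.

Lemma sum_D3_model m1 m2 (V : nmodType) (F : D3_model m1 m2 -> V) :
  \sum_g F g = \sum_a \sum_b \sum_c F (a, b, c).
Proof. by rewrite !pair_bigA; apply: eq_bigr => [[[a b] c]]. Qed.

(** * Faithfulness of the representations, by Fourier inversion *)

Section Injectivity.
Variables (m1 m2 : nat) (E : fieldType) (z1 z2 : E).
Hypothesis z1P : (2 ^ m1.+1).-primitive_root z1.
Hypothesis z2P : (2 ^ m2.+1).-primitive_root z2.
Local Notation H := (D3_model m1 m2).

(** Inversion one coordinate at a time on the underlying product of three cyclic groups. Here [w]
    may have order 2^(m1+1), and then [D3_lin] is not a character of the group. *)
Lemma D3_fourier (B : H -> E) :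
    (forall e s w, e ^+ 2 = 1 -> s ^+ (2 ^ m2.+1) = 1 -> w ^+ (2 ^ m1.+1) = 1 ->
       \sum_g B g * D3_lin e s w g = 0) ->
  forall g, B g = 0.
Proof.
move=> B0 [[a b] c].
have z0P : 2.-primitive_root (z1 ^+ (2 ^ m1)).
  have := dvdn_prim_root z1P (dvdn_exp2l 2 (isT : 1 <= m1.+1)%N).
  by rewrite -expnB // subn1.
apply: (@fourier_inj _ _ z1 (fun c => B (a, b, c))) => [|w wn].
  by rewrite Zp_trunc_exp2.
pose Bc a b := \sum_(c : 'Z_(2 ^ m1.+1)) B (a, b, c) * w ^+ c.
apply: (@fourier_inj _ _ z2 (Bc a)) => [|s sn].
  by rewrite Zp_trunc_exp2.
pose Bb a := \sum_(b : 'Z_(2 ^ m2.+1)) Bc a b * s ^+ b.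
apply: (@fourier_inj _ _ _ Bb z0P) => [e e2].
rewrite !Zp_trunc_exp2 in wn sn.
rewrite -[RHS](B0 e s w e2 sn wn).
rewrite sum_D3_model; apply: eq_bigr => i _.
rewrite mulr_suml; apply: eq_bigr => j _; rewrite !mulr_suml; apply: eq_bigr => k _.
by rewrite /D3_lin /D3_rword /=; ring.
Qed.

(** In [D3_fourier], w^(2^m1) is 1 or -1. In the first case the function is a linear character; in
    the second [D3_quat_eigen] with tau = s^2 expresses it by entries of a two-dimensional
    representation. *)
Lemma D3_reps_faithful (B : H -> E) :
    (forall e s w, e ^+ 2 = 1 -> s ^+ (2 ^ m2.+1) = 1 -> w ^+ (2 ^ m1) = 1 ->
       \sum_g B g * D3_lin e s w g = 0) ->
    (forall tau w, tau ^+ (2 ^ m2) = 1 -> w ^+ (2 ^ m1) = -1 ->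
       forall p q, \sum_g B g * D3_quat tau w g p q = 0) ->
  forall g, B g = 0.
Proof.
move=> lin0 quat0; apply: D3_fourier => e s w e2 sn wn.
have [w1|wN1] := eqVneq (w ^+ (2 ^ m1)) 1; first exact: lin0.
have {wN1} wN : w ^+ (2 ^ m1) = -1.
  have /eqP : (w ^+ (2 ^ m1)) ^+ 2 = 1 by rewrite -exprM -expnSr.
  by rewrite sqrf_eq1 (negPf wN1) => /eqP.
have [p ->] : exists p : 'I_2, e = (-1) ^+ p.
  move/eqP: e2; rewrite sqrf_eq1 => /orP[]/eqP ->; last by exists 1; rewrite expr1.
  by exists 0; rewrite expr0.
have s0 : (if p == 0 then s else 1) != 0.
  case: (p == 0); rewrite ?oner_eq0 //; apply/eqP=> s0.
  by have := oner_neq0 E; rewrite -sn s0 expr0n expn_eq0 eqxx.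
apply: (mulIf s0); rewrite mul0r mulr_suml.
under eq_bigr => g _ do rewrite -mulrA -D3_quat_eigen mulrDr mulrA.
have tn : (s ^+ 2) ^+ (2 ^ m2) = 1 by rewrite -exprM -expnS.
by rewrite big_split -mulr_suml /= !(quat0 _ _ tn wN) mul0r addr0.
Qed.

End Injectivity.

(** * Galois orbits of characters *)

Lemma sum_orbit_transversal (aT : finGroupType) (rT : finType)
    (to : {action aT &-> rT}) (G : {group aT}) (S : {set rT}) (F : rT -> nat) :
    [acts G, on S | to] ->
    (forall x a, a \in G -> F (to x a) = F x) ->
  (\sum_(x in S) F x
     = \sum_(r in orbit_transversal to G S) #|orbit to G r| * F r)%N.
Proof.
move=> actS Fto; have [_ /subsetP sXS inX repX] := orbit_transversalP actS.
rewrite (set_partition_big _ (orbit_partition actS)) /=.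
have -> : orbit to G @: S = orbit to G @: orbit_transversal to G S.
  apply/setP=> B; apply/imsetP/imsetP=> [[x Sx ->]|[x Xx ->]]; last first.
    by exists x; rewrite ?sXS.
  have [a Ga Xxa] := repX x Sx; exists (to x a) => //.
  by apply/esym/orbit_eqP; rewrite mem_orbit.
rewrite big_imset /= => [|x y Xx Xy /orbit_eqP]; last first.
  by rewrite orbit_sym inX // => /eqP.
apply: eq_bigr => r _; rewrite -sum_nat_const.
by apply: eq_bigr => _ /orbitP[a Ga <-]; apply: Fto.
Qed.

Section GaloisOrbits.
Variables (K : fieldType) (E : splittingFieldType K) (N : nat) (z : E).
Hypotheses (galE : galois 1 {:E}) (zP : N.-primitive_root z).
Local Notation Gam := ('Gal({:E} / 1))%G.

(** The cyclotomic character, an exponent modulo N; the default 0 never occurs. *)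
Definition gexp (s : gal_of {:E}) : nat :=
  oapp (@nat_of_ord N) 0 [pick i : 'I_N | s z == z ^+ i].

Lemma gexpE (s : gal_of {:E}) : s z = z ^+ gexp s.
Proof.
have /(prim_rootP zP)[i szi] : s z ^+ N = 1.
  by rewrite -rmorphXn (prim_expr_order zP) rmorph1.
by rewrite /gexp; case: pickP => [j /eqP //|/(_ i)]; rewrite szi eqxx.
Qed.

Lemma gexp1 : gexp 1%g = 1 %[mod N].
Proof. by apply/eqP; rewrite -(eq_prim_root_expr zP) -gexpE gal_id. Qed.

Lemma gexpM (s t : gal_of {:E}) : gexp (s * t)%g = gexp s * gexp t %[mod N].
Proof.
apply/eqP; rewrite -(eq_prim_root_expr zP) -gexpE galM ?memvf // gexpE rmorphXn /=.
by rewrite gexpE -exprM mulnC.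
Qed.

Variables (T : finGroupType).
Hypothesis TN : forall v : T, (v ^+ N = 1)%g.

Lemma expg_congr (v : T) i j : i = j %[mod N] -> (v ^+ i = v ^+ j)%g.
Proof. by move=> ij; rewrite -(expg_mod i (TN v)) ij expg_mod. Qed.

(* The action on characters, the character group being identified with T through
   powers of z. *)
Definition gal_act (v : T) (s : gal_of {:E}) : T := (v ^+ gexp s)%g.
Lemma gal_act1 : gal_act^~ 1%g =1 id.
Proof. by move=> v; rewrite /gal_act (expg_congr _ gexp1). Qed.
Lemma gal_actM v : act_morph gal_act v.
Proof. by move=> s t; rewrite /gal_act (expg_congr _ (gexpM s t)) expgM. Qed.
Definition gal_action : {action gal_of {:E} &-> T} :=
  TotalAction gal_act1 gal_actM.

Definition root_of_order o := z ^+ (N %/ o).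

Lemma root_of_orderP o : (o %| N)%N -> o.-primitive_root (root_of_order o).
Proof. exact: dvdn_prim_root. Qed.

Definition cyclo_field o : {subfield E} := <<1; root_of_order o>>%AS.

Lemma cyclo_fieldP o x : (o %| N)%N -> x ^+ o = 1 -> x \in cyclo_field o.
Proof.
move=> oN /(prim_rootP (root_of_orderP oN))[i ->].
by rewrite rpredX // memv_adjoin.
Qed.

(** An automorphism fixes v exactly when its exponent is 1 modulo the order o of v, that is when it
    fixes the o-th roots of unity. The stabilizer is thus the Galois group over [cyclo_field o], and
    the orbit-stabilizer formula gives the degree. *)
Lemma card_gal_orbit (v : T) :
  #|orbit gal_action Gam v| = \dim (cyclo_field #[v]%g).
Proof.
set o := #[v]%g; have oN : (o %| N)%N by rewrite order_dvdn TN.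
set M := cyclo_field o.
have galM : galois M {:E}.
  by apply: galoisS galE; rewrite subvf sub1v.
have stab : 'C_Gam[v | gal_action]%g = 'Gal({:E} / M)%g.
  apply/setP=> s; rewrite inE; have -> : s \in Gam.
    rewrite /= gal_kHom ?sub1v //; apply/kAHomP=> _ /vlineP[k ->].
    by rewrite linearZ /= rmorph1.
  have oP := root_of_orderP oN.
  have sroot : s (root_of_order o) = root_of_order o ^+ gexp s.
    by rewrite /root_of_order rmorphXn /= gexpE -!exprM mulnC.
  rewrite /= gal_kHom ?subvf //; apply/astab1P/idP.
    move=> vs; apply/kAHomP=> x Mx.
    suff sM : (M <= fixedField [set s])%VS.
      by move/(subvP sM)/(fixedFieldP (memvf x)): Mx => ->; rewrite ?set11.
    apply/FadjoinP; split; first exact: sub1v.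
    apply/(fixedFieldP (memvf _)) => _ /set1P ->.
    rewrite sroot; apply/eqP; rewrite -[eqbRHS]expr1 (eq_prim_root_expr oP).
    by rewrite -eq_expg_mod_order expg1; apply/eqP/vs.
  move/kAHomP/(_ (root_of_order o) (memv_adjoin _ _)).
  rewrite sroot => /eqP; rewrite -[eqbRHS]expr1 (eq_prim_root_expr oP).
  by rewrite -eq_expg_mod_order expg1 => /eqP.
have := card_orbit_in_stab gal_action v (subsetT Gam).
rewrite stab -!galois_dim // dimv1 divn1.
have Egt0 : (0 < \dim {:E})%N by rewrite adim_gt0.
have /dvdnP[q Eq] : (\dim M %| \dim {:E})%N by rewrite field_dimS ?subvf.
have Mgt0 : (0 < \dim M)%N by rewrite adim_gt0.
move: Egt0; rewrite Eq mulnK // muln_gt0 => /andP[qgt0 _] /eqP.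
by rewrite mulnC eqn_pmul2l // => /eqP.
Qed.

End GaloisOrbits.

Lemma expg_pair (gT rT : finGroupType) (v : gT * rT) i :
  (v ^+ i)%g = (v.1 ^+ i, v.2 ^+ i)%g.
Proof. by elim: i => // i IH; rewrite !expgS IH. Qed.

Lemma val_ZpX k (i : 'Z_(2 ^ k.+1)) e :
  (i ^+ e)%g = ((i * e) %% 2 ^ k.+1)%N :> nat.
Proof. by rewrite Zp_expg; congr (_ %% _)%N; apply: Zp_trunc_exp2. Qed.

Section Characters.
Variables (K : fieldType) (E : splittingFieldType K) (n : nat) (z : E).
Hypothesis zP : (2 ^ n).-primitive_root z.

Definition chi k (i : 'Z_(2 ^ k.+1)) : E :=
  root_of_order (2 ^ n) z (2 ^ k.+1) ^+ i.

Section One.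
Variable k : nat.
Hypothesis kn : (k < n)%N.

Let wP : (2 ^ k.+1).-primitive_root (root_of_order (2 ^ n) z (2 ^ k.+1)).
Proof. by apply: root_of_orderP => //; rewrite dvdn_exp2l. Qed.

Lemma chi_root (i : 'Z_(2 ^ k.+1)) : chi i ^+ (2 ^ k.+1) = 1.
Proof. by rewrite /chi exprAC (prim_expr_order wP) expr1n. Qed.

Lemma chiX (i : 'Z_(2 ^ k.+1)) e : chi (i ^+ e)%g = chi i ^+ e.
Proof.
by rewrite /chi -exprM val_ZpX (expr_mod _ (prim_expr_order wP)).
Qed.

Lemma chi_surj u : u ^+ (2 ^ k.+1) = 1 -> exists i : 'Z_(2 ^ k.+1), u = chi i.
Proof.
move/(prim_rootP wP)=> [i ->].
by exists (cast_ord (esym (Zp_trunc_exp2 k)) i).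
Qed.

Lemma expg_Zp_exp2 (i : 'Z_(2 ^ k.+1)) : (i ^+ (2 ^ n))%g = 1%g.
Proof.
apply/eqP; rewrite -order_dvdn (@dvdn_trans (2 ^ k.+1)) ?dvdn_exp2l //.
rewrite -[X in (_ %| X)%N](Zp_trunc_exp2 k) -[X in (_ %| X)%N]card_ord -cardsT.
by rewrite order_dvdG ?inE.
Qed.

Lemma gal_chi (s : gal_of {:E}) (i : 'Z_(2 ^ k.+1)) :
  s (chi i) = chi (i ^+ gexp (2 ^ n) z s)%g.
Proof.
rewrite chiX /chi /root_of_order !rmorphXn /= (gexpE zP) -!exprM.
by congr (z ^+ _); rewrite mulnC mulnA mulnAC.
Qed.

Lemma chi_mem (i : 'Z_(2 ^ k.+1)) o : (o %| 2 ^ n)%N -> (i ^+ o)%g = 1%g ->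
  chi i \in cyclo_field (2 ^ n) z o.
Proof.
move=> on io; apply: cyclo_fieldP => //.
by rewrite -chiX io /chi expr0.
Qed.

Lemma chi_inj : injective (@chi k).
Proof.
have ltN (i : 'Z_(2 ^ k.+1)) : (i < 2 ^ k.+1)%N.
  exact: leq_trans (ltn_ord i) (eq_leq (Zp_trunc_exp2 k)).
move=> i j /eqP; rewrite (eq_prim_root_expr wP) !modn_small //.
by move/eqP/val_inj.
Qed.

End One.

End Characters.

(* With m1 = l.+2 and m2 = j.+1: the linear characters, and the pairs (tau, w)
   with w a primitive 2 ^ m1-th root of unity. *)
Definition lin_index (l j : nat) : finGroupType :=
  ('Z_(2 ^ 1) * 'Z_(2 ^ j.+2) * 'Z_(2 ^ l.+1))%type.
Definition quat_index (l j : nat) : finGroupType :=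
  ('Z_(2 ^ j.+1) * 'Z_(2 ^ l.+2))%type.
Definition quat_set (l j : nat) : {set quat_index l j} :=
  [set v | v.2 ^+ (2 ^ l.+1) != 1]%g.

(** * Counting orbits *)

Local Open Scope nat_scope.

Lemma card_Zp_torsion k e :
  #|[set i : 'Z_(2 ^ k.+1) | (i ^+ (2 ^ e) == 1)%g]| = 2 ^ minn k.+1 e.
Proof.
have kill (i : 'Z_(2 ^ k.+1)) : (i ^+ (2 ^ e) == 1)%g = (2 ^ k.+1 %| i * 2 ^ e).
  by rewrite -val_eqE /= val_ZpX.
have ltN (i : 'Z_(2 ^ k.+1)) : i < 2 ^ k.+1.
  exact: leq_trans (ltn_ord i) (eq_leq (Zp_trunc_exp2 k)).
have [ek|ke] := leqP k.+1 e.
  rewrite (_ : [set i | _] = setT) ?cardsT ?card_ord ?Zp_trunc_exp2 //.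
  by apply/setP=> i; rewrite !inE kill dvdn_mull // dvdn_exp2l.
(* The elements killed by 2^e are the multiples of d, and there are 2^e of them. *)
pose d := 2 ^ (k.+1 - e).
have dE : d * 2 ^ e = 2 ^ k.+1 by rewrite -expnD subnK // ltnW.
have killd m : (2 ^ k.+1 %| m * 2 ^ e) = (d %| m).
  by rewrite -dE dvdn_pmul2r ?expn_gt0.
have d0 : 0 < d by rewrite expn_gt0.
have ltd (c : 'I_(2 ^ e)) : c * d < (Zp_trunc (2 ^ k.+1)).+2.
  by rewrite Zp_trunc_exp2 -dE mulnC ltn_pmul2l.
rewrite -[RHS]card_ord -(card_imset _ (f := fun c => Ordinal (ltd c))); last first.
  by move=> c c' /(congr1 val) /eqP; rewrite /= eqn_pmul2r // => /eqP/val_inj.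
congr #|pred_of_set _|; apply/setP=> i; rewrite inE kill killd.
apply/idP/imsetP=> [/dvdnP[c ic]|[c _ ->]]; last by rewrite dvdn_mull.
have ce : c < 2 ^ e by have := ltN i; rewrite ic -dE mulnC ltn_pmul2l.
by exists (Ordinal ce) => //; apply: val_inj.
Qed.

Lemma card_order_exp2 (T : finGroupType) (S : {set T}) k :
  #|[set v in S | #[v]%g == 2 ^ k.+1]| =
  #|[set v in S | (v ^+ (2 ^ k.+1) == 1)%g]| -
  #|[set v in S | (v ^+ (2 ^ k) == 1)%g]|.
Proof.
rewrite -cardsDS; last first.
  apply/subsetP=> v; rewrite !inE => /andP[-> /eqP v1].
  by rewrite expnSr expgM v1 expg1n eqxx.
apply: eq_card => v; rewrite !inE; case: (v \in S) => //=.
rewrite -!order_dvdn; apply/eqP/andP=> [->|[nk /dvdn_pfactor[//|e ek ve]]].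
  by rewrite dvdnn dvdn_Pexp2l // ltnn.
by move: nk; rewrite ve dvdn_Pexp2l // -ltnNge => ke; congr (2 ^ _); lia.
Qed.

(* X plays the role of a transversal of the orbits in S, d o of the size of the
   orbits of the elements of order o, and c k of the number of rational orbits of
   order 2 ^ k; note that 2 ^ k.-1 is 1 both for k = 0 and k = 1. *)
Section OrbitCount.
Variables (T : finGroupType) (S X : {set T}) (d c : nat -> nat) (n : nat).
Hypothesis TN : forall v : T, (v ^+ (2 ^ n) = 1)%g.
Hypothesis sumX : forall F : nat -> nat,
  \sum_(v in S) F #[v]%g = \sum_(r in X) d #[r]%g * F #[r]%g.
Hypothesis cardS : forall k, #|[set v in S | #[v]%g == 2 ^ k]| = 2 ^ k.-1 * c k.

(** The summation formula is tested on the indicator of the order 2^k. *)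
Lemma orbit_count k :
  d (2 ^ k) * #|[set r in X | #[r]%g == 2 ^ k]| = 2 ^ k.-1 * c k.
Proof.
rewrite -cardS -!sum1dep_card !big_mkcondr /=.
rewrite (sumX (fun o => if o == 2 ^ k then 1 else 0)) big_distrr; apply: eq_bigr => r _ /=.
by case: eqP => [->|]; rewrite ?muln0.
Qed.

Lemma card_orbits : #|X| = \sum_(k < n.+1) #|[set r in X | #[r]%g == 2 ^ k]|.
Proof.
rewrite -sum1_card.
have lg (v : T) : exists2 k, k < n.+1 & #[v]%g = 2 ^ k.
  have /dvdn_pfactor[//|k kn vk] : #[v]%g %| 2 ^ n by rewrite order_dvdn TN.
  by exists k.
rewrite (partition_big (fun v : T => inord (logn 2 #[v]%g) : 'I_n.+1) predT) //=.
apply: eq_bigr => k _; rewrite -sum1dep_card; apply: eq_bigl => v.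
by have [e en ->] := lg v; rewrite pfactorK // eqn_exp2l // -val_eqE /= inordK.
Qed.

Lemma orbits_rational : (forall k, k <= n -> d (2 ^ k) = 2 ^ k.-1) ->
  #|X| = \sum_(k < n.+1) c k.
Proof.
move=> dE; rewrite card_orbits; apply: eq_bigr => k _.
have /eqP := orbit_count k; rewrite dE -1?ltnS //.
by rewrite eqn_pmul2l ?expn_gt0 // => /eqP.
Qed.

(* The index in (Z / 2 ^ k)^* of the subgroup generated by 3. *)
Definition double_from3 k := if k < 3 then 1 else 2.

Lemma orbits_finite_ge :
    (forall k, k <= n -> d (2 ^ k) * double_from3 k <= 2 ^ k.-1) ->
  \sum_(k < n.+1) double_from3 k * c k <= #|X|.
Proof.
move=> dE; rewrite card_orbits; apply: leq_sum => k _.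
have := orbit_count k; have := dE k; rewrite -ltnS ltn_ord => /(_ isT).
set D := d _; set x := #|_|; set e := double_from3 _; set p := 2 ^ _ => De Dx.
have p0 : 0 < p by rewrite expn_gt0.
have D0 : 0 < p * c k -> 0 < D by rewrite -Dx; case: (D).
nia.
Qed.

Lemma orbits_finite_eq :
    (forall k, k <= n -> d (2 ^ k) * double_from3 k = 2 ^ k.-1) ->
  #|X| = \sum_(k < n.+1) double_from3 k * c k.
Proof.
move=> dE; rewrite card_orbits; apply: eq_bigr => k _.
have := orbit_count k; have := dE k; rewrite -ltnS ltn_ord => /(_ isT).
have : 0 < 2 ^ k.-1 by rewrite expn_gt0.
set D := d _; set x := #|_|; set e := double_from3 _; set p := 2 ^ _ => De Dx.
nia.
Qed.

End OrbitCount.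

Lemma expg_exp2_le (gT : finGroupType) (v : gT) k n :
  k <= n -> (v ^+ (2 ^ k))%g = 1%g -> (v ^+ (2 ^ n))%g = 1%g.
Proof. by move=> kn vk; rewrite -(subnKC kn) expnD expgM vk expg1n. Qed.

Section Counts.
Variables l j : nat.

Lemma card_lin_torsion k :
  #|[set v in [set: lin_index l j] | (v ^+ (2 ^ k) == 1)%g]| =
  2 ^ (minn 1 k + minn j.+2 k + minn l.+1 k).
Proof.
rewrite !expnD -(card_Zp_torsion 0 k) -(card_Zp_torsion j.+1 k).
rewrite -(card_Zp_torsion l k) -!cardsX; apply: eq_card => -[[a b] c].
by rewrite !inE expg_pair [X in (X, _)]expg_pair /= !xpair_eqE.
Qed.

(** The second coordinate has order exactly 2^(l+2), which rules out smaller k and leaves 2^(l+1)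
    choices for it. *)
Lemma card_quat_torsion k :
  #|[set v in quat_set l j | (v ^+ (2 ^ k) == 1)%g]| =
  if k < l.+2 then 0 else 2 ^ (minn j.+1 k + l.+1).
Proof.
have killZ (i : 'Z_(2 ^ l.+2)) e : l.+2 <= e -> (i ^+ (2 ^ e))%g = 1%g.
  by move=> le; apply: (expg_exp2_le le); apply: expg_Zp_exp2.
case: ltnP => [kl|lk].
  apply/eqP; rewrite cards_eq0; apply/eqP/setP=> -[a b]; rewrite !inE expg_pair /=.
  apply/negP=> /andP[/negP b1]; rewrite xpair_eqE => /andP[_ /eqP bk]; apply: b1.
  by rewrite (expg_exp2_le _ bk).
have -> : [set v in quat_set l j | (v ^+ (2 ^ k) == 1)%g] =
  setX [set i : 'Z_(2 ^ j.+1) | (i ^+ (2 ^ k) == 1)%g]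
       (~: [set i : 'Z_(2 ^ l.+2) | (i ^+ (2 ^ l.+1) == 1)%g]).
  apply/setP=> -[a b]; rewrite !inE expg_pair xpair_eqE /= (killZ b k) //.
  by rewrite eqxx andbT andbC.
rewrite cardsX [#|~: _|]cardsCs setCK !card_Zp_torsion card_ord Zp_trunc_exp2.
rewrite expnD; congr (_ * _); rewrite (minn_idPr _) // [2 ^ l.+2]expnS; lia.
Qed.

Lemma card_quat_set : #|quat_set l j| = 2 ^ (j.+1 + l.+1).
Proof.
have := card_quat_torsion (l.+2 + j); rewrite ltnNge leq_addr /=.
rewrite (minn_idPl _) => [<-|]; last by rewrite addSn ltnS leq_addl.
have kill k (i : 'Z_(2 ^ k.+1)) :
    k.+1 <= l.+2 + j -> (i ^+ (2 ^ (l.+2 + j)))%g = 1%g.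
  by move=> le_k; apply: (expg_exp2_le le_k); apply: expg_Zp_exp2.
by apply: eq_card => v; rewrite !inE expg_pair !kill ?eqxx ?andbT //; lia.
Qed.

(* lin_mult k and quat_mult k are the numbers of orbits of elements of order
   2 ^ k over the rationals, that is of cyclic subgroups in the case of
   lin_mult. *)
Definition lin_mult k :=
  if k == 0 then 1 else if k == 1 then 7
  else if k <= minn j.+2 l.+1 then 3 * 2 ^ k
  else if k <= maxn j.+2 l.+1 then 2 ^ (minn j.+2 l.+1).+1 else 0.

Definition quat_mult k :=
  if k < l.+2 then 0 else if k == l.+2 then 2 ^ minn j.+1 l.+2
  else if k <= j.+1 then 2 ^ l.+1 else 0.

Lemma card_set1_order1 (T : finGroupType) (S : {set T}) :
  #|[set v in S | #[v]%g == 2 ^ 0]| = (1%g \in S).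
Proof.
have [S1|S1] := boolP (1%g \in S).
  apply: etrans (cards1 (1%g : T)); apply: eq_card => v; rewrite !inE order_eq1.
  by rewrite andbC; case: eqP => // ->.
apply/eqP; rewrite cards_eq0; apply/eqP/setP=> v; rewrite !inE order_eq1.
by apply/negbTE/negP=> /andP[Sv /eqP v1]; rewrite -v1 Sv in S1.
Qed.

Lemma card_lin_order k : 0 < l ->
  #|[set v in [set: lin_index l j] | #[v]%g == 2 ^ k]| = 2 ^ k.-1 * lin_mult k.
Proof.
move=> l0; case: k => [|k]; first by rewrite card_set1_order1 inE.
rewrite card_order_exp2 !card_lin_torsion /lin_mult /=.
case: k => [|k].
  have -> : minn 1 1 + minn j.+2 1 + minn l.+1 1 = 3 by lia.
  by rewrite !minn0.
rewrite (minn_idPl (isT : 1 <= k.+2)) (minn_idPl (isT : 1 <= k.+1)) /=.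
have B2 : 1 < minn j.+2 l.+1 by lia.
have le_BA : minn j.+2 l.+1 <= maxn j.+2 l.+1 by lia.
(* Only the smaller and the larger of the two exponents matter; the count changes shape at each of
   them. *)
have minE i : minn j.+2 i + minn l.+1 i =
   minn (minn j.+2 l.+1) i + minn (maxn j.+2 l.+1) i by lia.
rewrite -!addnA !minE; move: (minn j.+2 _) (maxn _ _) B2 le_BA => b a b2 ba.
case: ifP => [kb|bk].
  have -> : 1 + (minn b k.+2 + minn a k.+2) = k + k + 5 by lia.
  have -> : 1 + (minn b k.+1 + minn a k.+1) = k + k + 3 by lia.
  by rewrite !(expnD, expnS) /=; lia.
case: ifP => [ka|ak].
  have -> : 1 + (minn b k.+2 + minn a k.+2) = b + k + 3 by lia.
  have -> : 1 + (minn b k.+1 + minn a k.+1) = b + k + 2 by lia.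
  by rewrite !(expnD, expnS) /=; lia.
by rewrite !(minn_idPl _) ?subnn ?muln0 //; lia.
Qed.

Lemma card_quat_order k :
  #|[set v in quat_set l j | #[v]%g == 2 ^ k]| = 2 ^ k.-1 * quat_mult k.
Proof.
case: k => [|k]; first by rewrite card_set1_order1 inE /= expg1n eqxx.
rewrite card_order_exp2 !card_quat_torsion /quat_mult /=.
case: (ltngtP k.+1 l.+2) => [kl|lk|kl].
- by rewrite muln0.
- case: ifP => [kj|jk]; last by rewrite !(minn_idPl _) ?subnn ?muln0 //; lia.
  have [-> ->] : minn j.+1 k.+1 = k.+1 /\ minn j.+1 k = k by lia.
  by rewrite !(expnD, expnS); lia.
by rewrite -kl subn0 expnD mulnC; case: kl => ->.
Qed.

Lemma sum_lin_mult n : maxn j.+2 l.+1 <= n -> 0 < l ->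
  \sum_(k < n.+1) lin_mult k =
  (3 + (maxn j.+2 l.+1 - minn j.+2 l.+1)) * 2 ^ (minn j.+2 l.+1).+1 - 4.
Proof.
move=> an l0; have B2 : 1 < minn j.+2 l.+1 by lia.
have le_BA : minn j.+2 l.+1 <= maxn j.+2 l.+1 by lia.
rewrite /lin_mult; move: (minn _ _) (maxn _ _) B2 le_BA an => b a b2 ba an.
(* Partial sums, by induction; truncation by [minn] handles the three ranges of orders. The constant
   4 comes from 1 + 7 = 3 * 2^2 - 4. *)
suff S k : \sum_(i < k.+2) (if i == 0 :> nat then 1 else if i == 1 :> nat then 7
    else if i <= b then 3 * 2 ^ i else if i <= a then 2 ^ b.+1 else 0) =
    (3 + (minn k.+1 a - b)) * 2 ^ (minn k.+1 b).+1 - 4.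
  case: n an => [|n] an; first lia.
  by rewrite S (minn_idPr an) (minn_idPr _) //; lia.
elim: k => [|k IH].
  rewrite !big_ord_recr big_ord0 /=.
  by have [-> ->] : minn 1 a - b = 0 /\ minn 1 b = 1 by lia.
rewrite big_ord_recr IH /=; case: ifP => [kb|bk].
  have [-> ->] : minn k.+1 a - b = 0 /\ minn k.+1 b = k.+1 by lia.
  have [-> ->] : minn k.+2 a - b = 0 /\ minn k.+2 b = k.+2 by lia.
  rewrite !expnS; have : 0 < 2 ^ k by rewrite expn_gt0.
  by lia.
have -> : minn k.+1 b = b by lia.
have -> : minn k.+2 b = b by lia.
have : 4 <= 2 ^ b.+1 by rewrite (leq_exp2l 2 _ (isT : 1 < 2)); lia.
case: ifP => [ka|ak].
  have -> : minn k.+2 a - b = (minn k.+1 a - b).+1 by lia.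
  by nia.
have -> : minn k.+2 a - b = minn k.+1 a - b by lia.
by rewrite addn0.
Qed.

Lemma sum_quat_mult n : maxn j.+1 l.+2 <= n ->
  \sum_(k < n.+1) quat_mult k = 2 ^ minn j.+1 l.+2 + (j.+1 - l.+2) * 2 ^ l.+1.
Proof.
move=> an; suff S k : \sum_(i < k) quat_mult i =
    if k <= l.+2 then 0
    else 2 ^ minn j.+1 l.+2 + (minn k.-1 j.+1 - l.+2) * 2 ^ l.+1.
  rewrite S ltnNge (leq_trans (leq_maxr _ _) an) /=.
  by have -> : minn n j.+1 = j.+1 by lia.
elim: k => [|k IH]; first by rewrite big_ord0.
rewrite big_ord_recr IH /= /quat_mult.
case: (ltngtP k l.+2) => [kl|lk|->] //=.
  case: ifP => [kj|jk].
    have -> : minn k j.+1 - l.+2 = (minn k.-1 j.+1 - l.+2).+1 by lia.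
    by rewrite mulSn; lia.
  by rewrite addn0; have -> : minn k j.+1 - l.+2 = minn k.-1 j.+1 - l.+2 by lia.
have -> : minn l.+2 j.+1 - l.+2 = 0 by lia.
by rewrite mul0n addn0.
Qed.

End Counts.

Local Open Scope ring_scope.

(** * The decomposition of the group algebra *)

Section Decomposition.
Variables (l j : nat) (K : fieldType) (E : splittingFieldType K) (n : nat) (z : E).
Hypotheses (galE : galois 1 {:E}) (zP : (2 ^ n).-primitive_root z).
Hypotheses (ln : (l.+1 < n)%N) (jn : (j.+1 < n)%N).
Local Notation H := (D3_model l.+1 j.+1).
Local Notation lin_index := (lin_index l j).
Local Notation quat_index := (quat_index l j).
Local Notation quat_set := (quat_set l j).

Lemma lin_indexN (v : lin_index) : (v ^+ (2 ^ n) = 1)%g.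
Proof. by rewrite !expg_pair !expg_Zp_exp2 //; move: ln jn; clear; lia. Qed.
Lemma quat_indexN (v : quat_index) : (v ^+ (2 ^ n) = 1)%g.
Proof. by rewrite expg_pair !expg_Zp_exp2 //; move: ln jn; clear; lia. Qed.

Definition lin_rep (v : lin_index) : H -> E :=
  D3_lin (chi n z v.1.1) (chi n z v.1.2) (chi n z v.2).
Definition quat_rep (v : quat_index) : H -> 'M[E]_2 :=
  D3_quat (chi n z v.1) (chi n z v.2).

Local Notation lin_act := (gal_action zP lin_indexN).
Local Notation quat_act := (gal_action zP quat_indexN).

Lemma gal_lin_rep (s : gal_of {:E}) v h :
  s (lin_rep v h) = lin_rep (v ^+ gexp (2 ^ n) z s)%g h.
Proof.
by rewrite /lin_rep !expg_pair /= -!(gal_chi zP) ?D3_lin_map //; lia.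
Qed.

Lemma gal_quat_rep (s : gal_of {:E}) v h :
  map_mx s (quat_rep v h) = quat_rep (v ^+ gexp (2 ^ n) z s)%g h.
Proof.
by rewrite /quat_rep !expg_pair /= -!(gal_chi zP) ?D3_quat_map //; lia.
Qed.

Lemma acts_quat_set : [acts 'Gal({:E} / 1)%g, on quat_set | quat_act].
Proof.
have sub s v : v \notin quat_set -> quat_act v s \notin quat_set.
  rewrite !inE !negbK /= /gal_act expg_pair /= -expgM mulnC expgM => /eqP->.
  by rewrite expg1n.
apply/actsP=> s _ v; apply/idP/idP; apply: contraTT; first exact: sub.
by move/(sub s^-1%g); rewrite actK.
Qed.

Local Notation cfield o := (subvs_of (cyclo_field (2 ^ n) z o)).
(** A mere linear projection, applied to character values, which already lie in the subfield. *)
Definition cproj o (x : E) : cfield o := vsproj (cyclo_field (2 ^ n) z o) x.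

Lemma cproj_chi k (i : 'Z_(2 ^ k.+1)) o : (k < n)%N -> (o %| 2 ^ n)%N ->
  (i ^+ o = 1)%g -> vsval (cproj o (chi n z i)) = chi n z i.
Proof. by move=> kn on io; rewrite vsprojK // (chi_mem zP). Qed.

Definition lin_field_rep (v : lin_index) : H -> cfield #[v]%g :=
  D3_lin (cproj _ (chi n z v.1.1)) (cproj _ (chi n z v.1.2)) (cproj _ (chi n z v.2)).
Definition quat_field_rep (v : quat_index) : H -> 'M[cfield #[v]%g]_2 :=
  D3_quat (cproj _ (chi n z v.1)) (cproj _ (chi n z v.2)).

Lemma lin_projE (v : lin_index) :
  [/\ vsval (cproj #[v]%g (chi n z v.1.1)) = chi n z v.1.1,
      vsval (cproj #[v]%g (chi n z v.1.2)) = chi n z v.1.2 &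
      vsval (cproj #[v]%g (chi n z v.2)) = chi n z v.2].
Proof.
have oN : (#[v]%g %| 2 ^ n)%N by rewrite order_dvdn lin_indexN.
have := expg_order v; rewrite !expg_pair => -[v11 v12 v2].
by split; apply: cproj_chi => //; lia.
Qed.

Lemma quat_projE (v : quat_index) :
  vsval (cproj #[v]%g (chi n z v.1)) = chi n z v.1 /\
  vsval (cproj #[v]%g (chi n z v.2)) = chi n z v.2.
Proof.
have oN : (#[v]%g %| 2 ^ n)%N by rewrite order_dvdn quat_indexN.
have := expg_order v; rewrite expg_pair => -[v1 v2].
by split; apply: cproj_chi => //; lia.
Qed.

Lemma lin_field_repE v h : vsval (lin_field_rep v h) = lin_rep v h.
Proof. by rewrite D3_lin_map /=; have [-> -> ->] := lin_projE v. Qed.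

Lemma quat_field_repE v h p q : vsval (quat_field_rep v h p q) = quat_rep v h p q.
Proof.
have [e1 e2] := quat_projE v; rewrite /quat_rep -e1 -e2.
by rewrite -(D3_quat_map vsval) [RHS]mxE.
Qed.

Lemma lin_field_repM v : {morph lin_field_rep v : g h / (g * h)%g >-> g * h}.
Proof.
have [e1 e2 e3] := lin_projE v.
apply: D3_linM; apply: val_inj; rewrite rmorphXn rmorph1 /=.
- by rewrite e1 (chi_root zP) //; lia.
- by rewrite e2 (chi_root zP).
- by rewrite e3 (chi_root zP) //; lia.
Qed.

Lemma quat_chiN (v : quat_index) : v \in quat_set -> chi n z v.2 ^+ (2 ^ l.+1) = -1.
Proof.
rewrite inE => v2; have /eqP : (chi n z v.2 ^+ (2 ^ l.+1)) ^+ 2 = 1.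
  by rewrite -exprM -expnSr (chi_root zP).
rewrite sqrf_eq1 => /orP[|/eqP //]; rewrite -(chiX zP) // => /eqP v1.
by case/eqP: v2; apply: (chi_inj zP ln); rewrite v1 /chi expr0.
Qed.

Lemma quat_field_repM v : v \in quat_set ->
  {morph quat_field_rep v : g h / (g * h)%g >-> g * h}.
Proof.
move=> Sv; have [e1 e2] := quat_projE v.
apply: D3_quatM; apply: val_inj; rewrite rmorphXn ?rmorphN rmorph1 /=.
- by rewrite e1 (chi_root zP) //; lia.
- by rewrite e2 quat_chiN.
Qed.

Local Notation Gam := ('Gal({:E} / 1))%G.
Definition lin_orbits := orbit_transversal lin_act Gam [set: lin_index].
Definition quat_orbits := orbit_transversal quat_act Gam quat_set.

Lemma acts_lin_set : [acts Gam, on [set: lin_index] | lin_act].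
Proof. by apply/actsP=> s _ v; rewrite !inE. Qed.

Lemma order_gal_act (T : finGroupType) (TN : forall v : T, (v ^+ (2 ^ n) = 1)%g)
    (v : T) s : #[gal_action zP TN v s]%g = #[v]%g.
Proof.
have dvd w t : (#[gal_action zP TN w t]%g %| #[w]%g)%N.
  by rewrite order_dvdn /= /gal_act -expgM mulnC expgM expg_order expg1n.
apply/eqP; rewrite eqn_dvd dvd /=.
by rewrite -{1}(actK (gal_action zP TN) s v) dvd.
Qed.

Lemma sum_lin_orbits (F : nat -> nat) :
  (\sum_(v : lin_index) F #[v]%g =
   \sum_(r in lin_orbits) \dim (cyclo_field (2 ^ n) z #[r]%g) * F #[r]%g)%N.
Proof.
transitivity (\sum_(v in [set: lin_index]) F #[v]%g)%N.
  by apply: eq_bigl => v; rewrite inE.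
rewrite (sum_orbit_transversal (F := fun v => F #[v]%g) acts_lin_set) => [|v s _].
  by apply: eq_bigr => v _; rewrite (card_gal_orbit galE).
by rewrite order_gal_act.
Qed.

Lemma sum_quat_orbits (F : nat -> nat) :
  (\sum_(v in quat_set) F #[v]%g =
   \sum_(r in quat_orbits) \dim (cyclo_field (2 ^ n) z #[r]%g) * F #[r]%g)%N.
Proof.
rewrite (sum_orbit_transversal (F := fun v => F #[v]%g) acts_quat_set) => [|v s _].
  by apply: eq_bigr => v _; rewrite (card_gal_orbit galE).
by rewrite order_gal_act.
Qed.

Variables (gT : finGroupType) (f : gT -> H).
Hypotheses (f_bij : bijective f) (fM : {morph f : g h / (g * h)%g}).

Lemma group_iso1 : f 1%g = 1%g.
Proof. by apply: (mulgI (f 1%g)); rewrite -fM !mulg1. Qed.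

Local Notation r1 := (fun i : 'I_#|lin_orbits| => enum_val i).
Local Notation r2 := (fun i : 'I_#|quat_orbits| => enum_val i).

(** One component for each field and four, the matrix entries, for each matrix ring, so that every
    component takes its values in [E]. *)
Definition component : finType :=
  ('I_#|lin_orbits| + 'I_#|quat_orbits| * ('I_2 * 'I_2))%type.
Definition component_space (i : component) : {vspace E} :=
  match i with
  | inl i => cyclo_field (2 ^ n) z #[r1 i]%g
  | inr (i, _) => cyclo_field (2 ^ n) z #[r2 i]%g
  end.
Definition component_map (i : component) (g : gT) : E :=
  match i with
  | inl i => lin_rep (r1 i) (f g)
  | inr (i, (p, q)) => quat_rep (r2 i) (f g) p q
  end.

Lemma component_map_mem i g : component_map i g \in component_space i.
Proof.
case: i => [i|[i [p q]]] /=; first by rewrite -lin_field_repE subvsP.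
by rewrite -quat_field_repE subvsP.
Qed.

Lemma card_gT : #|gT| = (2 ^ (l + j + 5))%N.
Proof. by rewrite (bij_eq_card f_bij) card_D3_model; congr (2 ^ _)%N; lia. Qed.

(** The orbit sums with F = 1 count all characters: 2^(l+j+4) linear ones, and 2^(l+j+2)
    two-dimensional ones with four entries each, which makes 2^(l+j+5). *)
Lemma sum_dim_component : (\sum_i \dim (component_space i) <= #|gT|)%N.
Proof.
rewrite big_sumType /=; pose d v := \dim (cyclo_field (2 ^ n) z v).
rewrite (eq_bigr (fun i : 'I_#|quat_orbits| * ('I_2 * 'I_2) =>
  (fun i _ => d #[r2 i]%g) i.1 i.2)); last by case.
rewrite -(pair_bigA _ (fun i _ => d #[r2 i]%g)) /=.
under [X in (_ + X)%N]eq_bigr => i _ do rewrite sum_nat_const card_prod card_ord.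
rewrite -big_distrr /=.
rewrite -(big_enum_val (fun v => d #[v]%g)) -(big_enum_val (fun v => d #[v]%g)).
have := sum_lin_orbits (fun=> 1%N); have := sum_quat_orbits (fun=> 1%N).
rewrite !sum_nat_const muln1 card_quat_set card_gT.
under eq_bigr => v _ do rewrite muln1; move=> <-.
under eq_bigr => v _ do rewrite muln1; move=> <-.
rewrite muln1 !card_prod !card_ord !Zp_trunc_exp2.
by rewrite !expn1 !(expnS, expnD); lia.
Qed.

(** Vanishing at the orbit representatives spreads to all characters by conjugation, and
    [D3_reps_faithful] concludes. *)
Lemma component_map_inj (b : {ffun gT -> K^o}) :
  coord_map component_map b = 0 -> b = 0.
Proof.
move=> b0.
have b0i i : \sum_g (b g : K) *: component_map i g = 0.
  by have /ffunP/(_ i) := b0; rewrite !ffunE.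
have [f' fK f'K] := f_bij.
pose B h : E := (b (f' h) : K)%:A.
have sumB (F : H -> E) : \sum_h B h * F h = \sum_g (b g : K) *: F (f g).
  rewrite (reindex f); last exact: onW_bij.
  by apply: eq_bigr => g _; rewrite /B fK mulr_algl.
(* The coefficients of b lie in K and are fixed by s, so the sums for F and for its conjugate vanish
   together. *)
have gal_sum (s : gal_of {:E}) (F : H -> E) :
    \sum_g (b g : K) *: s (F (f g)) = 0 -> \sum_h B h * F h = 0.
  rewrite sumB => F0; apply: (fmorph_inj s); rewrite rmorph0 -[RHS]F0 rmorph_sum /=.
  by apply: eq_bigr => g _; rewrite linearZ.
(* In characteristic 2 the root z^(2^(n-1)) would be 1, against primitivity. *)
have twoN : -1 != 1 :> E.
  apply/eqP=> N1; have n0 : (0 < n)%N by lia.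
  have : (z ^+ (2 ^ n.-1)) ^+ 2 = 1.
    by rewrite -exprM -expnSr prednK // (prim_expr_order zP).
  move/eqP; rewrite sqrf_eq1 N1 orbb -(prim_order_dvd zP).
  by rewrite dvdn_Pexp2l // leqNgt ltn_predL n0.
suff B0 h : B h = 0.
  apply/ffunP=> g; have /eqP := B0 (f g).
  by rewrite /B fK ffunE scaler_eq0 oner_eq0 orbF => /eqP.
apply: (D3_reps_faithful (root_of_orderP zP (dvdn_exp2l 2 ln))
  (root_of_orderP zP (dvdn_exp2l 2 jn))) => [e s w e2 sn wn|tau w tn wn p q].
  have [i1 ei1] := chi_surj zP (leq_ltn_trans (leq0n _) ln) e2.
  have [i2 si2] := chi_surj zP jn sn.
  have [i3 wi3] := chi_surj zP (ltnW ln) wn.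
  have [_ _ _ /(_ (i1, i2, i3))] := orbit_transversalP acts_lin_set.
  rewrite inE => -[//|a _ Xa].
  apply: (gal_sum a); rewrite ei1 si2 wi3.
  rewrite -[RHS](b0i (inl (enum_rank_in Xa (lin_act (i1, i2, i3) a)))).
  by apply: eq_bigr => g _; rewrite /= enum_rankK_in // -gal_lin_rep.
have [i1 ei1] := chi_surj zP (ltnW jn) tn.
have w2 : w ^+ (2 ^ l.+2) = 1 by rewrite expnSr exprM wn sqrrN expr1n.
have [i2 wi2] := chi_surj zP ln w2.
have Sv : (i1, i2) \in quat_set.
  rewrite inE; apply: contraNneq twoN => i21.
  by rewrite -wn wi2 -(chiX zP) // i21 /chi expr0.
have [_ _ _ /(_ _ Sv)] := orbit_transversalP acts_quat_set.
case=> a _ Xa; apply: (gal_sum a); rewrite ei1 wi2.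
rewrite -[RHS](b0i (inr (enum_rank_in Xa (quat_act (i1, i2) a), (p, q)))).
apply: eq_bigr => g _; rewrite /= enum_rankK_in // -gal_quat_rep.
by rewrite [in RHS]mxE.
Qed.

Lemma lin_field_rep1 v : lin_field_rep v 1%g = 1.
Proof. exact: D3_rword1. Qed.

Lemma quat_field_rep1 v : quat_field_rep v 1%g = 1.
Proof. exact: D3_rword1. Qed.

Lemma r2_mem i : r2 i \in quat_set.
Proof.
have [_ /subsetP sub _ _] := orbit_transversalP acts_quat_set.
exact/sub/enum_valP.
Qed.

Lemma D3_decomposition : sum_of_fields_and_quaternions (group_algebra K gT)
  #|lin_orbits| #|quat_orbits|.
Proof.
pose Fi (i : 'I_#|lin_orbits|) : fieldExtType K := cfield #[r1 i]%g.
pose Lj (i : 'I_#|quat_orbits|) : fieldExtType K := cfield #[r2 i]%g.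
pose Aj i : falgType (Lj i) := 'M[Lj i]_2.
have phi i : {phi : {lrmorphism group_algebra K gT -> Fi i}
    | forall b, vsval (phi b) = coord_map component_map b (inl i)}.
  have [||||p pE] := @galg_lift_lrmorphism K gT (Fi i) *:%R (in_alg (Fi i))
      (fun g => lin_field_rep (r1 i) (f g)).
  - by move=> k a /=; rewrite mulr_algl.
  - by move=> k a /=; rewrite mulrC.
  - by rewrite group_iso1 lin_field_rep1.
  - by move=> g h; rewrite fM lin_field_repM.
  exists p => b; rewrite pE ffunE /galg_lift linear_sum; apply: eq_bigr => g _.
  by rewrite linearZ; congr (_ *: _); apply: lin_field_repE.
have psi i : {psi : {lrmorphism group_algebra K gT -> Aj i | in_alg (Lj i) \; *:%R}
    | forall b p q,
        vsval (psi b p q) = coord_map component_map b (inr (i, (p, q)))}.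
  have [||||p pE] := @galg_lift_lrmorphism K gT (Aj i) (in_alg (Lj i) \; *:%R)
      (in_alg (Aj i) \o in_alg (Lj i))
      (fun g => quat_field_rep (r2 i) (f g)).
  - by move=> k a /=; rewrite mulr_algl.
  - by move=> k a /=; rewrite mulr_algl mulr_algr.
  - by rewrite group_iso1 quat_field_rep1.
  - by move=> g h; rewrite fM quat_field_repM ?r2_mem.
  exists p => b s t; rewrite pE ffunE /galg_lift summxE linear_sum.
  apply: eq_bigr => g _ /=.
  by rewrite mxE mulr_algl linearZ /= quat_field_repE.
exists Fi, Lj, Aj, (fun i => sval (phi i)), (fun i => sval (psi i)); split.
  by move=> i; apply: mx2_quaternion.
move=> u v.
pose w : {ffun component -> E} := [ffun i => match i with
  | inl i => vsval (u i) | inr (i, (p, q)) => vsval (v i p q) end].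
have [i|b bw] := coord_map_surj component_map_mem sum_dim_component
  component_map_inj (w := w).
  by rewrite ffunE; case: i => [i|[i [p q]]]; apply: subvsP.
exists b; split=> [|c [phic psic]].
  split=> i; first by apply: val_inj; rewrite /= (svalP (phi i)) bw ffunE.
  by apply/matrixP=> p q; apply: val_inj; rewrite /= (svalP (psi i)) bw ffunE.
(* Uniqueness: all components of the difference b - c vanish. *)
apply/eqP; rewrite -subr_eq0; apply/eqP/component_map_inj.
rewrite linearB /= bw; apply/eqP; rewrite subr_eq0; apply/eqP/ffunP=> -[i|[i [p q]]].
  by rewrite -(svalP (phi i)) phic ffunE.
by rewrite -(svalP (psi i)) psic ffunE.
Qed.

End Decomposition.

(** * Degrees of cyclotomic extensions *)

Lemma dim_Fadjoin1 (K : fieldType) (E : fieldExtType K) (y : E) :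
  (\dim <<1; y>>).+1 = size (minPoly 1 y).
Proof. by rewrite size_minPoly dim_Fadjoin dimv1 muln1. Qed.

(** The embedding [f] compares the minimal polynomial of [y] with that of [f y], which is known to
    be cyclotomic: each divides the other. *)
Lemma dim_cyclotomic_rat (E : fieldExtType rat) (f : {rmorphism E -> algC})
    (y : E) o :
  o.-primitive_root y -> \dim <<1; y>> = totient o.
Proof.
move=> yP; have yC : o.-primitive_root (f y) by rewrite fmorph_primitive_root.
have [p [pE mon_p] pdiv] := minCpolyP (f y).
have szp : size p = (totient o).+1.
  by rewrite -(size_cyclotomic (f y)) -minCpoly_cyclotomic // pE size_map_poly.
have mapE q : map_poly f (map_poly (in_alg E) q) = map_poly ratr q.
  rewrite -map_poly_comp; apply: eq_map_poly => a.
  by rewrite /= alg_num_field fmorph_rat.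
have rootE q : root (map_poly (in_alg E) q) y = (p %| q).
  by rewrite -pdiv -mapE fmorph_root.
apply: succn_inj; rewrite dim_Fadjoin1 -szp; apply/eqP; rewrite eqn_leq.
have p0 : p != 0 by rewrite monic_neq0.
apply/andP; split.
  rewrite -(size_map_poly (in_alg E)) dvdp_leq ?map_poly_eq0 //.
  by rewrite minPoly_dvdp ?rootE ?dvdpp //; apply/polyOver1P; exists p.
have /polyOver1P[q qE] := minPolyOver 1 y.
have q0 : q != 0.
  by rewrite -(map_poly_eq0 (in_alg E)) -qE monic_neq0 ?monic_minPoly.
by rewrite qE size_map_poly dvdp_leq // -rootE -qE root_minPoly.
Qed.

Section FiniteBase.
Variables (K : finFieldType) (E : splittingFieldType K) (y : E) (o : nat).
Hypothesis yP : o.-primitive_root y.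
Local Notation q := #|K|.

(** The field generated by [y] has q^d elements, d its degree, so y^(q^d) = y. With
    [dim_cyclotomic_le] this makes d the order of q modulo o. *)
Lemma expf_dim_cyclotomic : (o %| q ^ \dim <<1; y>> - 1)%N.
Proof.
have := memv_adjoin 1 y; rewrite Fermat's_little_theorem => /eqP yq.
rewrite -eqn_mod_dvd ?expn_gt0 ?(ltnW (finNzRing_gt1 _)) //.
by rewrite -(eq_prim_root_expr yP) yq expr1.
Qed.

Lemma dim_cyclotomic_le e :
  (0 < e)%N -> (o %| q ^ e - 1)%N -> (\dim <<1; y>> <= e)%N.
Proof.
case: e => // e _; rewrite -eqn_mod_dvd ?expn_gt0 ?(ltnW (finNzRing_gt1 _)) //.
rewrite -(eq_prim_root_expr yP) expr1 => /eqP yq.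
(* The conjugates of y are among the y ^+ (q ^ i), and p is fixed by Frobenius. *)
pose p := \prod_(i < e.+1) ('X - (y ^+ (q ^ i))%:P).
have [a _ aE] := finField_galois_generator (sub1v {:E}).
have aq (x : E) : a x = x ^+ q by rewrite aE ?memvf // dimv1 expn1.
have ap : map_poly a p = p.
  (* Frobenius shifts the factors by one, and the last becomes the first because y^(q^(e+1)) = y. *)
  rewrite rmorph_prod /p big_ord_recr big_ord_recl /= mulrC.
  congr (_ * _).
    by rewrite rmorphB /= map_polyX map_polyC /= aq -exprM -expnSr yq expn0 expr1.
  apply: eq_bigr => i _.
  by rewrite rmorphB /= map_polyX map_polyC /= aq -exprM -expnSr.
have p1 : p \is a polyOver 1%VS.
  apply/polyOverP=> i; rewrite (Fermat's_little_theorem 1%AS) /= dimv1 expn1.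
  by rewrite -aq -coef_map ap.
rewrite -ltnS dim_Fadjoin1 -[X in (_ <= X)%N](_ : size p = _); last first.
  by rewrite size_prod_XsubC /= /index_enum -enumT size_enum_ord.
rewrite dvdp_leq ?monic_neq0 ?monic_prod_XsubC // minPoly_dvdp //.
by apply/rootP; rewrite horner_prod big_ord_recl !hornerE expn0 expr1 subrr mul0r.
Qed.

End FiniteBase.

(** * Powers of odd numbers modulo powers of two *)

Local Open Scope nat_scope.

(** An odd square is 1 modulo 8, and each further squaring gains a factor 2 from x^2 - 1 = (x - 1)(x
    + 1). *)
Lemma odd_expn2_dvd q k : odd q -> 2 ^ k.+3 %| q ^ (2 ^ k.+1) - 1.
Proof.
move=> oq; elim: k => [|k IH].
  rewrite -eqn_mod_dvd ?expn_gt0 ?odd_gt0 // -modnXm.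
  have : odd (q %% 8) by lia.
  by have := ltn_pmod q (isT : 0 < 8); case: (q %% 8) => [|[|[|[|[|[|[|[|]]]]]]]].
have sqrB1 x : x ^ 2 - 1 = (x - 1) * (x + 1) by rewrite -subn_sqr exp1n.
rewrite [2 ^ k.+2]expnSr expnM sqrB1 [2 ^ k.+4]expnSr.
by rewrite dvdn_mul // dvdn2 oddD oddX oq orbT.
Qed.

(** Sharpness of [odd_expn2_dvd]: q^2 is 9 modulo 16, and squaring a number that is 1 + M modulo 2M
    gives 1 + 2M modulo 4M when 4 divides M. *)
Lemma expn2_mod_3mod8 q k : q = 3 %[mod 8] ->
  q ^ (2 ^ k.+1) = 1 + 2 ^ k.+3 %[mod 2 ^ k.+4].
Proof.
move=> q3; elim: k => [|k IH].
  rewrite -modnXm.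
  have : q %% 16 = 3 \/ q %% 16 = 11 by lia.
  by case=> [->|->].
rewrite [2 ^ k.+2]expnSr expnM.
set x := q ^ _ in IH *; move/eqP: IH; set M := 2 ^ k.+3.
have -> : 2 ^ k.+4 = M * 2 by rewrite -expnSr.
have -> : 2 ^ k.+1.+4 = M * 4 by rewrite /M !expnS; lia.
have [c ->] : exists c, M = 4 * c by exists (2 ^ k.+1); rewrite /M !expnS; lia.
move=> H.
have xE := divn_eq x (4 * c * 2).
have [c0|c0] := posnP c.
  by move: H; rewrite c0 !muln0 !mul0n !modn0 !addn0 => /eqP ->.
have rE : x %% (4 * c * 2) = 1 + 4 * c.
  by rewrite (eqP H) modn_small //; lia.
rewrite rE in xE; set w := x %/ _ in xE; rewrite xE.
have -> : (w * (4 * c * 2) + (1 + 4 * c)) ^ 2 =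
   (w * w * c * 4 + w * (1 + 4 * c) + c) * (4 * c * 4) + (1 + 4 * c * 2) by ring.
by rewrite modnMDl.
Qed.

(** In the induction step d = 2^(k+1) d'. If d' were odd, q^d would be (1 + M)^d' = 1 + M modulo 2M
    with M = 2^(k+3), hence not 1. *)
Lemma expn_dvd_3mod8 q k d : q = 3 %[mod 8] -> 2 ^ k.+3 %| q ^ d - 1 -> 2 ^ k.+1 %| d.
Proof.
move=> q3; have q0 : 0 < q by lia.
elim: k d => [|k IH] d.
  rewrite -eqn_mod_dvd ?expn_gt0 ?q0 // -modnXm q3 dvdn2.
  rewrite -[in X in X -> _](odd_double_half d) expnD -mul2n expnM.
  by rewrite -modnMmr -modnXm exp1n; case: (odd d).
move=> dv; have /dvdnP[d' dE] : 2 ^ k.+1 %| d.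
  by apply: IH; apply: dvdn_trans dv; rewrite dvdn_exp2l.
rewrite dE [2 ^ k.+2]expnS dvdn_pmul2r ?expn_gt0 // dvdn2.
apply/negP=> od; move: dv; rewrite -eqn_mod_dvd ?expn_gt0 ?q0 // dE mulnC expnM.
rewrite -modnXm (expn2_mod_3mod8 k q3) modnXm.
set M := 2 ^ k.+3; have -> : 2 ^ k.+4 = M * 2 by rewrite -expnSr.
have [c c0 Mc] : exists2 c, 0 < c & M = 2 * c.
  by exists (2 ^ k.+2); rewrite ?expn_gt0 // /M expnS.
have sq : (1 + M) ^ 2 = 1 %[mod M * 2].
  by rewrite Mc (_ : (1 + 2 * c) ^ 2 = (1 + c) * (2 * c * 2) + 1) ?modnMDl //; ring.
rewrite -(odd_double_half d') od expnD -mul2n expnM -modnMmr -modnXm sq.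
by rewrite modnXm exp1n modnMmr muln1 expn1 !modn_small; lia.
Qed.

Local Open Scope ring_scope.

Lemma finField_two_neq0 (K : finFieldType) : odd #|K| -> 2%:R != 0 :> K.
Proof.
move=> oK; apply/eqP=> two0.
have := @expg_cardG K [set: K]%G 1%R (in_setT _).
rewrite cardsT FinRing.zmodXgE -(odd_double_half #|K|) oK -muln2 mulrnDr mulrnA.
rewrite -[_ *+ 2]mulr_natr two0 mulr0 addr0 => one0.
by have /eqP := one0 : 1 = 0 :> K; rewrite oner_eq0.
Qed.

(** X^N - 1 is separable because N is invertible in K, so its N roots in a splitting field include a
    primitive one. *)
Lemma finField_prim_root (K : finFieldType) N : N%:R != 0 :> K ->
  exists (E : splittingFieldType K) (z : E), N.-primitive_root z.
Proof.
move=> N0; have Ngt0 : (0 < N)%N by case: (N) N0; rewrite ?eqxx.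
have p0 : 'X^N - 1 != 0 :> {poly K} by rewrite monic_neq0 // monicXnsubC.
have [E [rs p_rs _]] := FinSplittingFieldFor p0; exists E.
have {p_rs} : 'X^N - 1 %= \prod_(x <- rs) ('X - x%:P).
  by move: p_rs; rewrite rmorphB /= map_polyXn rmorph1.
rewrite eqp_monic ?monicXnsubC ?monic_prod_XsubC // => /eqP pE.
have rs1 : all N.-unity_root rs.
  by apply/allP=> x xrs; rewrite /root_of_unity pE root_prod_XsubC.
have rsN : (N <= size rs)%N by rewrite -ltnS -(size_prod_XsubC rs id) -pE size_XnsubC.
have rsU : uniq rs.
  rewrite -separable_prod_XsubC -pE separable_Xn_sub_1 //.
  by rewrite -(rmorph_nat (in_alg E)) fmorph_eq0.
by have /hasP[z _ zP] := has_prim_root Ngt0 rs1 rsU rsN; exists z.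
Qed.

Local Open Scope nat_scope.

(** * Closed formulas for the numbers of orbits *)

Section Values.
Variables l j : nat.
Hypotheses (l1 : 1 <= l) (j2 : 2 <= j).

Lemma D3_N0_sum n : maxn j.+2 l.+2 <= n ->
  \sum_(k < n.+1) lin_mult l j k = D3_N0 l.+2 j.+1.
Proof.
move=> hn; rewrite sum_lin_mult //; last lia.
rewrite /D3_N0; case: ifP => [c1|c1].
  have -> : minn j.+2 l.+1 = j.+2 by lia.
  have -> : j.+1 + 2 = j.+3 by lia.
  by rewrite mulnC; congr (_ * _ - 4); lia.
case: eqP => [c2|c2].
  have -> : l = j by lia.
  have -> : 3 + (maxn j.+2 j.+1 - minn j.+2 j.+1) = 4 by lia.
  have -> : minn j.+2 j.+1 = j.+1 by lia.
  by rewrite [2 ^ j.+2]expnS; lia.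
have -> : minn j.+2 l.+1 = l.+1 by lia.
by rewrite mulnC; congr (_ * _ - 4); lia.
Qed.

(** The rational orbits of orders 1, 2 and 4 alone number 1 + 7 + 12. The bound keeps the
    subtraction in [D3_M0] from truncating. *)
Lemma D3_N0_ge : 20 <= D3_N0 l.+2 j.+1.
Proof.
rewrite -(D3_N0_sum (leqnn _)).
have -> : maxn j.+2 l.+2 = (maxn j l).+2 by lia.
rewrite !big_ord_recl /= /lin_mult /=.
have -> : (bump 0 (bump 0 0) <= minn j.+2 l.+1) by rewrite /bump /=; lia.
by rewrite /bump /=; lia.
Qed.

Lemma D3_N_sum n : maxn j.+2 l.+2 <= n ->
  \sum_(k < n.+1) quat_mult l j k = D3_N l.+2 j.+1 - D3_N0 l.+2 j.+1.
Proof.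
move=> hn; have := D3_N0_ge; rewrite sum_quat_mult; last lia.
rewrite /D3_N0 /D3_N; case: ifP => [c1|c1].
  have -> : minn j.+1 l.+2 = j.+1 by lia.
  have -> : j.+1 - l.+2 = 0 by lia.
  have -> : j.+1 + 2 = j.+3 by lia.
  have [m ->] : exists m, l = j + m by exists (l - j); lia.
  have -> : 5 + 4 * (j + m).+2 - 4 * j.+1 = 4 * m + 9 by lia.
  have -> : 1 + (j + m).+2 - j.+1 = m + 2 by lia.
  by rewrite !expnS; move: (2 ^ j) => p; nia.
case: eqP => [c2|c2].
  have -> : minn j.+1 l.+2 = j.+1 by lia.
  have -> : j.+1 - l.+2 = 0 by lia.
  by lia.
have -> : minn j.+1 l.+2 = l.+2 by lia.
rewrite subn1 /=.
have [m jE] : exists m, j.+1 = l.+2 + m by exists (j.+1 - l.+2); lia.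
have -> : j.+1 - l.+2 = m by lia.
have -> : 12 + 3 * j.+1 - 3 * l.+2 = 3 * m + 12 by lia.
have -> : 5 + j.+1 - l.+2 = m + 5 by lia.
by rewrite !expnS; move: (2 ^ l) => p; nia.
Qed.

(** Orders 1, 2 and 4 have weight 1 and all others weight 2, so 1 + 7 + 12 = 20 is subtracted from
    twice the rational count. *)
Lemma sum_double_lin n : maxn j.+2 l.+2 <= n ->
  \sum_(k < n.+1) double_from3 k * lin_mult l j k = D3_M0 l.+2 j.+1.
Proof.
move=> hn; rewrite /D3_M0 -(D3_N0_sum hn).
case: n hn => [|[|n]] hn; try lia.
rewrite !big_ord_recl /= /double_from3 /=.
rewrite !mul1n -big_distrr /=.
have -> : lin_mult l j (bump 0 (bump 0 0)) = 12.
  by rewrite /lin_mult /bump /=; have -> : 2 <= minn j.+2 l.+1 by lia.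
have -> : lin_mult l j (bump 0 0) = 7 by [].
have -> : lin_mult l j 0 = 1 by [].
by lia.
Qed.

(** Quaternion orbits have order at least 2^(l+2) >= 8, so all are doubled, and the two constants 20
    cancel. *)
Lemma sum_double_quat n : maxn j.+2 l.+2 <= n ->
  \sum_(k < n.+1) double_from3 k * quat_mult l j k =
  D3_M l.+2 j.+1 - D3_M0 l.+2 j.+1.
Proof.
move=> hn; have := D3_N0_ge; rewrite /D3_M /D3_M0 => N0.
transitivity (2 * (D3_N l.+2 j.+1 - D3_N0 l.+2 j.+1)); last by lia.
rewrite -(D3_N_sum hn) big_distrr; apply: eq_bigr => k _ /=.
rewrite /double_from3; case: ifP => // k3.
by rewrite /quat_mult (leq_trans k3).
Qed.

End Values.

(** K enters the counts only through the degrees of its cyclotomic extensions. The three cases serve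
    the rationals, finite fields of odd order q, and q = 3 modulo 8. *)
Lemma D3_orbits_decomposition l j (K : fieldType) (E : splittingFieldType K)
    n (z : E) (gT : finGroupType) :
    0 < l -> maxn j.+2 l.+2 <= n -> galois 1 {:E} -> (2 ^ n).-primitive_root z ->
    type_D3 l.+2 j.+1 [set: gT] ->
  exists f h, [/\ sum_of_fields_and_quaternions (group_algebra K gT) f h,
     (forall k, k <= n -> \dim (cyclo_field (2 ^ n) z (2 ^ k)) = 2 ^ k.-1) ->
       f = \sum_(k < n.+1) lin_mult l j k /\ h = \sum_(k < n.+1) quat_mult l j k,
     (forall k, k <= n ->
        \dim (cyclo_field (2 ^ n) z (2 ^ k)) * double_from3 k <= 2 ^ k.-1) ->
       \sum_(k < n.+1) double_from3 k * lin_mult l j k <= f /\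
       \sum_(k < n.+1) double_from3 k * quat_mult l j k <= h &
     (forall k, k <= n ->
        \dim (cyclo_field (2 ^ n) z (2 ^ k)) * double_from3 k = 2 ^ k.-1) ->
       f = \sum_(k < n.+1) double_from3 k * lin_mult l j k /\
       h = \sum_(k < n.+1) double_from3 k * quat_mult l j k].
Proof.
move=> l0 nlj galE zP D3G.
have ln : l.+1 < n by lia.
have jn : j.+1 < n by lia.
have [f [f_bij fM]] := D3_model_iso D3G.
have dec := D3_decomposition galE zP ln jn f_bij fM.
have sl (F : nat -> nat) := sum_lin_orbits galE zP ln jn F.
have sl' (F : nat -> nat) : \sum_(v in [set: lin_index l j]) F #[v]%g =
    \sum_(r in lin_orbits zP ln jn)
      \dim (cyclo_field (2 ^ n) z #[r]%g) * F #[r]%g.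
  by rewrite -sl; apply: eq_bigl => v; rewrite inE.
have sq (F : nat -> nat) := sum_quat_orbits galE zP ln jn F.
pose d o := \dim (cyclo_field (2 ^ n) z o).
exists #|lin_orbits zP ln jn|, #|quat_orbits zP ln jn|; split=> // dE.
- split.
    apply: (orbits_rational (d := d) (lin_indexN ln jn) sl' _ dE).
    by move=> k; apply: card_lin_order.
  apply: (orbits_rational (d := d) (quat_indexN ln jn) sq _ dE).
  by move=> k; apply: card_quat_order.
- split.
    apply: (orbits_finite_ge (d := d) (lin_indexN ln jn) sl' _ dE).
    by move=> k; apply: card_lin_order.
  apply: (orbits_finite_ge (d := d) (quat_indexN ln jn) sq _ dE).
  by move=> k; apply: card_quat_order.
split.
  apply: (orbits_finite_eq (d := d) (lin_indexN ln jn) sl' _ dE).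
  by move=> k; apply: card_lin_order.
apply: (orbits_finite_eq (d := d) (quat_indexN ln jn) sq _ dE).
by move=> k; apply: card_quat_order.
Qed.

Lemma rat_prim_root N : 0 < N -> exists (E : splittingFieldType rat) (z : E),
  [/\ N.-primitive_root z, galois 1 {:E} & exists f : {rmorphism E -> algC}, True].
Proof.
(* [group_num_field_exists] gives a root of unity whose order is the cardinal of a group; any group
   with N elements serves. *)
move=> N0; have N1 : N = #|[set: 'I_N.-1.+1]| by rewrite cardsT card_ord prednK.
have [E galE [f _ [z [zP _] _]]] := group_num_field_exists [set: 'I_N.-1.+1]%G.
by exists E, z; rewrite N1; split=> //; exists f.
Qed.

Lemma totient_exp2 k : totient (2 ^ k) = 2 ^ k.-1.
Proof. by case: k => [|k] //; rewrite totient_pfactor // mul1n. Qed.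

(** The upper bounds come from 2 dividing q - 1 and from [odd_expn2_dvd]. If q = 3 modulo 8, then 4
    does not divide q - 1, and for k >= 3 [expn_dvd_3mod8] makes the degree a multiple of
    2^(k-2). *)
Lemma finField_dim_bounds (K : finFieldType) (E : splittingFieldType K) (y : E) k :
    odd #|K| -> (2 ^ k).-primitive_root y ->
  \dim <<1; y>> * double_from3 k <= 2 ^ k.-1 /\
  (#|K| = 3 %[mod 8] -> \dim <<1; y>> * double_from3 k = 2 ^ k.-1).
Proof.
move=> oq yP; have d0 : 0 < \dim <<1; y>> by rewrite (adim_gt0 <<1; y>>%AS).
have dle e := dim_cyclotomic_le yP (e := e).
have dvd := expf_dim_cyclotomic yP.
rewrite /double_from3.
case: k yP dle dvd => [|[|[|k]]] yP dle dvd /=; rewrite ?muln1.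
- have := dle 1 isT (dvd1n _); lia.
- have d1 : \dim <<1; y>> <= 1.
    by apply: dle => //; rewrite expn1 dvdn2 oddB ?odd_gt0 // oq.
  by lia.
- have d2 : \dim <<1; y>> <= 2.
    apply: dle => //; apply: dvdn_trans (odd_expn2_dvd 0 oq).
    by rewrite dvdn_exp2l.
  split=> // q3; apply/eqP; rewrite eqn_leq d2 ltn_neqAle d0 andbT.
  apply: contraTneq dvd => <-; rewrite expn1.
  rewrite (_ : 2 ^ 2 = 4) // -eqn_mod_dvd ?odd_gt0 //.
  by move: #|K| q3 => q q3; lia.
have d2 : \dim <<1; y>> <= 2 ^ k.+1 by apply: dle; rewrite ?expn_gt0 // odd_expn2_dvd.
rewrite [2 ^ k.+2]expnSr; split=> [|q3]; first by rewrite leq_pmul2r.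
by congr (_ * _); apply/eqP; rewrite eqn_leq d2 dvdn_leq // (expn_dvd_3mod8 q3).
Qed.

Theorem theorem5p2 (m1 m2 : nat) (gT : finGroupType)
    (hm1 : 3 <= m1) (hm2 : 3 <= m2) (hG : type_D3 m1 m2 [set: gT]) :
  sum_of_fields_and_quaternions (group_algebra rat gT)
    (D3_N0 m1 m2) (D3_N m1 m2 - D3_N0 m1 m2) /\
  (forall K : finFieldType, odd #|K| ->
     exists f h : nat,
       [/\ sum_of_fields_and_quaternions (group_algebra K gT) f h,
           D3_M0 m1 m2 <= f,
           D3_M m1 m2 - D3_M0 m1 m2 <= h
         & #|K| = 3 %[mod 8] ->
           f = D3_M0 m1 m2 /\ h = D3_M m1 m2 - D3_M0 m1 m2]).
Proof.
case: m1 m2 hm1 hm2 hG => [|[|l]] [|j] // l1 j2 D3G.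
(* Here y has order 2^(j+2) and t1 has order 2^(l+2), so the 2^n-th roots of unity contain all
   character values. *)
pose n := maxn j.+2 l.+2; have nn : maxn j.+2 l.+2 <= n by [].
split=> [|K oK].
  have [|E [z [zP galE [f _]]]] := @rat_prim_root (2 ^ n); first by rewrite expn_gt0.
  have [a [b [dec ab _ _]]] := D3_orbits_decomposition l1 nn galE zP D3G.
  have [|aE bE] := ab.
    move=> k kn; rewrite -totient_exp2; apply: (dim_cyclotomic_rat f).
    by apply: root_of_orderP => //; rewrite dvdn_exp2l.
  by rewrite -(D3_N_sum l1 j2 nn) -(D3_N0_sum l1 j2 nn) -aE -bE.
have [|E [z zP]] := @finField_prim_root K (2 ^ n).
  by rewrite natrX expf_neq0 // finField_two_neq0.
have galE : galois 1 {:E} by exact: finField_galois (sub1v _).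
have dimE k : k <= n -> _ := fun kn => finField_dim_bounds oK
   (root_of_orderP zP (dvdn_exp2l 2 kn)).
have [a [b [dec _ ab_ge ab_eq]]] := D3_orbits_decomposition l1 nn galE zP D3G.
have [|a_ge b_ge] := ab_ge; first by move=> k /dimE[].
exists a, b; split=> //.
- by rewrite -(sum_double_lin l1 j2 nn).
- by rewrite -(sum_double_quat l1 j2 nn).
move=> q3; rewrite -(sum_double_quat l1 j2 nn) -(sum_double_lin l1 j2 nn).
by apply: ab_eq => k /dimE[_ ->].
Qed.
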